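(* Let $\pi_1,\pi_2$ be projective representations of Möb on Hilbert spaces $H_1,H_2$, and suppose $T=\begin{bmatrix}T_1&0\\S_2&T_2\end{bmatrix}$ is a homogeneous operator on $H_1\oplus H_2$ with associated representation $\pi_1\oplus\pi_2$. Then, for all $\phi\in$ Möb, $\phi(z)=e^{i\theta}\frac{z-a}{1-\bar az}$, $$S_2\pi_1(\phi)-e^{i\theta}\pi_2(\phi)S_2=\bar a\,S_2\pi_1(\phi)T_1+\bar a\,T_2\pi_2(\phi)S_2 .$$ If, moreover, $\pi_1=R_{\lambda,\mu}$ ($-1<\lambda\le1$) is a representation from the Continuous series excluding $P_{1,0}$, and $\pi_2=D^+_{\lambda+2m}\oplus D^-_{2-\lambda+2k}$, where $m,k$ are integers with $\lambda+2m>0$ and $2-\lambda+2k>0$, then $S_2=0$.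
   Context: All Hilbert spaces are complex and separable and operators are bounded and linear. Möb is the locally compact group of maps $\phi_{\theta,a}(z)=e^{i\theta}\frac{z-a}{1-\bar a z}$, $\theta\in\mathbb R$, $a\in\mathbb D$. An operator $T$ is homogeneous if its spectrum lies in $\overline{\mathbb D}$ and $\phi(T)$ is unitarily equivalent to $T$ for all $\phi\in$ Möb. A projective representation of Möb is a Borel map $\pi$ into a unitary group with $\pi(1)=I$ and $\pi(gh)=m(g,h)\pi(g)\pi(h)$, $m$ Borel with values in $\mathbb T$. $\pi$ is associated with $T$ if $\phi(T)=\pi(\phi)^*T\pi(\phi)$ for all $\phi\in$ Möb. In the block matrix, $S_2:H_1\to H_2$. Fix for each $\phi=\phi_{\theta,a}$, $\theta\in(-\pi,\pi]$, the branch $\log\phi'(z)=i\theta+\log(1-|a|^2)-2\log(1-\bar az)$ (principal logarithm) and put $\phi'(z)^{\lambda/2}=\exp(\tfrac\lambda2\log\phi'(z))$. $R_{\lambda,\mu}$ is given by $(R_{\lambda,\mu}(\phi^{-1})f)(z)=\phi'(z)^{\lambda/2}|\phi'(z)|^{\mu}f(\phi(z))$. Continuous series (functions on $\mathbb T$): the Principal series $P_{\lambda,s}=R_{\lambda,\mu}$, $-1<\lambda\le1$, $s$ purely imaginary, $\mu=\frac{1-\lambda}2+s$, on $L^2(\mathbb T)$ (with $\{z^n\}$ orthonormal); and the Complementary series $C_{\lambda,\sigma}=R_{\lambda,\mu}$, $-1<\lambda<1$, $0<\sigma<\frac12(1-|\lambda|)$, $\mu=\frac{1-\lambda}2+\sigma$,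 on the Hilbert space with orthogonal basis $\{z^n\}_{n\in\mathbb Z}$ and $\|z^n\|^2=\prod_{k=0}^{|n|-1}\frac{k\pm\frac\lambda2+\frac12-\sigma}{k\pm\frac\lambda2+\frac12+\sigma}$ (sign $+$ for $n\ge0$, $-$ for $n<0$). Discrete series: for $\nu>0$, $D_\nu^+=R_{\nu,0}$ acts on the Hilbert space $H^{(\nu)}$ of holomorphic functions on $\mathbb D$ with orthogonal basis $\{z^n\}_{n\ge0}$, $\|z^n\|^2=\frac{\Gamma(n+1)\Gamma(\nu)}{\Gamma(n+\nu)}$; $D_\nu^-$ acts on the same space $H^{(\nu)}$ by $D_\nu^-(\phi)=D_\nu^+(\phi^* )$, $\phi^*(z)=\overline{\phi(\bar z)}$, the branch being the conjugate one, i.e. $(D^-_\nu(\phi^{-1})f)(z)=\overline{\phi'(\bar z)^{\nu/2}}\,f(\phi^*(z))$. *)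

(* Defs.v *)
From HB Require Import structures.
From mathcomp Require Import all_boot all_order all_algebra.
From mathcomp Require Import all_classical all_reals all_analysis.
From mathcomp Require Import complex ring.

Set Implicit Arguments.
Unset Strict Implicit.
Unset Printing Implicit Defensive.

Import Order.TTheory GRing.Theory Num.Theory.
Import numFieldNormedType.Exports.

Local Open Scope classical_set_scope.
Local Open Scope ring_scope.

Section ComplexFunctions.
Variable R : realType.
Implicit Types z : R[i].

Definition cabs z : R := complex.Re `|z|.

Definition cexp z : R[i] :=
  (expR (complex.Re z))%:C%C *
  (cos (complex.Im z) +i* sin (complex.Im z))%C.

(* principal value, in ]-pi, pi] *)
Definition carg z : R :=
  if 0 <= complex.Im z then acos (complex.Re z / cabs z)
  else - acos (complex.Re z / cabs z).

Definition cln z : R[i] := (ln (cabs z) +i* carg z)%C.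

Definition expi (t : R) : R[i] := (cos t +i* sin t)%C.

Definition Gamma (x : R) : R :=
  (\int[lebesgue_measure]_(t in `]0%R, +oo[) (t `^ (x - 1) * expR (- t)))%R.

End ComplexFunctions.

Section Mob.
Variable R : realType.
Notation C := R[i].

(* Mob u a stands for z |-> u (z - a) / (1 - a^* z) *)
Record mob := Mob {
  mob_u : C ;
  mob_a : C ;
  mob_uP : `|mob_u| = 1 ;
  mob_aP : `|mob_a| < 1 }.

Definition mob_fun (g : mob) (z : C) : C :=
  mob_u g * (z - mob_a g) / (1 - (mob_a g)^* * z).

Lemma mob_eq (g h : mob) : mob_u g = mob_u h -> mob_a g = mob_a h -> g = h.
Proof.
case: g h => [u a uP aP] [v b vP bP] /= uv ab.
by subst v b; congr Mob; exact: Prop_irrelevance.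
Qed.

Lemma mob_fun_inj (g h : mob) :
  (forall z, `|z| < 1 -> mob_fun g z = mob_fun h z) -> g = h.
Proof.
have nz (k : mob) (z : C) : `|z| < 1 -> 1 - (mob_a k)^* * z != 0.
  move=> z1; apply/eqP => /eqP; rewrite subr_eq0 => /eqP e.
  have : `|(mob_a k)^* * z| < 1.
    rewrite normrM norm_conjC mulr_ilt1 ?normr_ge0//; exact: mob_aP.
  by rewrite -e normr1 ltxx.
have unz (k : mob) : mob_u k != 0 by rewrite -normr_eq0 mob_uP oner_eq0.
move=> gh; have ea : mob_a g = mob_a h.
  have := gh _ (mob_aP g); rewrite /mob_fun subrr mulr0 mul0r => /esym/eqP.
  rewrite !mulf_eq0 (negbTE (unz h)) /= invr_eq0 (negbTE (nz _ _ (mob_aP g))).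
  by rewrite orbF subr_eq0 => /eqP.
apply: mob_eq => //.
have [z z1 za] : exists2 z : C, `|z| < 1 & z != mob_a h.
  have [a0|a0] := eqVneq (mob_a h) 0; last by exists 0; rewrite ?normr0// eq_sym.
  exists (2%:R^-1); last by rewrite a0 invr_eq0 pnatr_eq0.
  by rewrite normfV normr_nat invf_lt1 ?ltr1n// ltr0n.
have := gh z z1; rewrite /mob_fun ea => /(mulIf _)/(mulIf _); apply.
- by rewrite subr_eq0.
- by rewrite invr_eq0 nz.
Qed.

Lemma mob_den_neq0 (g : mob) (z : C) : `|z| <= 1 -> 1 - (mob_a g)^* * z != 0.
Proof.
move=> z1; apply/eqP => /eqP; rewrite subr_eq0 => /eqP e.
have : `|(mob_a g)^* * z| < 1.
  rewrite normrM norm_conjC; apply: le_lt_trans (mob_aP g).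
  by rewrite ler_piMr.
by rewrite -e normr1 ltxx.
Qed.

Lemma mob_u_conj (g : mob) : mob_u g * (mob_u g)^* = 1.
Proof. by rewrite -normCK mob_uP expr1n. Qed.

Lemma normC_lt (x y : C) : x * x^* < y * y^* -> `|x| < `|y|.
Proof. by rewrite -!normCK ltr_pXn2r// ?nnegrE. Qed.

Lemma normC_le (x y : C) : x * x^* <= y * y^* -> `|x| <= `|y|.
Proof. by rewrite -!normCK ler_pXn2r// ?nnegrE. Qed.

Lemma mob_fun_disc (g : mob) (z : C) : `|z| <= 1 -> `|mob_fun g z| <= 1.
Proof.
move=> z1; have d0 := mob_den_neq0 g z1.
rewrite /mob_fun !normrM mob_uP mul1r normfV ler_pdivrMr ?normr_gt0// mul1r.
apply: normC_le; rewrite -subr_ge0.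
set a := mob_a g.
rewrite !rmorphB !rmorphM rmorph1 /= ?conjCK.
rewrite (_ : _ - _ = (1 - a * a^*) * (1 - z * z^*)); last by ring.
rewrite -!normCK mulr_ge0// subr_ge0 expr_le1// ltW//; exact: mob_aP.
Qed.

Definition mob_den (g h : mob) : C := 1 + (mob_a g)^* * mob_u h * mob_a h.

Lemma mob_mul_den (g h : mob) : mob_den g h != 0.
Proof.
have /(mob_den_neq0 g) : `|- (mob_u h * mob_a h)| <= 1.
  by rewrite normrN normrM mob_uP mul1r ltW// mob_aP.
by rewrite mulrN opprK mulrA.
Qed.

Definition mob_mul_u (g h : mob) : C :=
  mob_u g * mob_u h * ((mob_den g h)^* / mob_den g h).

Definition mob_mul_a (g h : mob) : C :=
  (mob_a h + (mob_u h)^* * mob_a g) / (mob_den g h)^*.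

Lemma mob_mul_uP (g h : mob) : `|mob_mul_u g h| = 1.
Proof.
rewrite /mob_mul_u !normrM !mob_uP !mul1r normfV norm_conjC divff//.
by rewrite normr_eq0 mob_mul_den.
Qed.

Lemma mob_mul_aP (g h : mob) : `|mob_mul_a g h| < 1.
Proof.
have d0 := mob_mul_den g h.
rewrite /mob_mul_a normrM normfV norm_conjC ltr_pdivrMr ?normr_gt0// mul1r.
apply: normC_lt; rewrite -subr_gt0 /mob_den.
rewrite !rmorphD !rmorphM rmorph1 /= ?conjCK.
have uu := mob_u_conj h.
rewrite (_ : _ - _ =
  (1 - mob_a g * (mob_a g)^*) * (1 - mob_a h * (mob_a h)^*)
  + (mob_u h * (mob_u h)^* - 1) * (mob_a g * (mob_a g)^*)
     * (mob_a h * (mob_a h)^* - 1)); last by ring.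
rewrite uu subrr !mul0r addr0 -!normCK.
by rewrite mulr_gt0// subr_gt0 expr_lt1// mob_aP.
Qed.

Definition mob_mul (g h : mob) : mob := Mob (mob_mul_uP g h) (mob_mul_aP g h).

Lemma mob_mulE (g h : mob) (z : C) : `|z| <= 1 ->
  mob_fun (mob_mul g h) z = mob_fun g (mob_fun h z).
Proof.
move=> z1.
have d0 := mob_mul_den g h; have dh := mob_den_neq0 h z1.
have dg := mob_den_neq0 g (mob_fun_disc h z1).
have dgh := mob_den_neq0 (mob_mul g h) z1.
have uu := mob_u_conj h.
have u0 : mob_u h != 0 by rewrite -normr_eq0 mob_uP oner_eq0.
have d0' : (mob_den g h)^* != 0 by rewrite conjC_eq0.
move: dgh dg; rewrite /mob_fun /= /mob_mul_a /mob_mul_u.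
rewrite fmorph_div rmorphD rmorphM /= ?conjCK.
have -> : (mob_u h)^* = (mob_u h)^-1 by rewrite -[RHS]mulr1 -uu mulKf.
move: d0 d0'; rewrite /mob_den rmorphD !rmorphM rmorph1 /= ?conjCK.
have -> : (mob_u h)^* = (mob_u h)^-1 by rewrite -[RHS]mulr1 -uu mulKf.
move=> d0 d0' dgh dg; field; apply/and5P; split=> //.
- have := mulf_neq0 dg dh; rewrite mulrBl mul1r [in X in _ - X]mulrA.
  by rewrite -[_ / _ * _]mulrA mulrA divfK// mulrA.
- have := mulf_neq0 d0' u0; rewrite mulrDl mul1r.
  by rewrite -[_ / _ * _]mulrA [_^-1 * _]mulrC mulrA divfK// .
Qed.

Lemma mob_one_uP : `|1 : C| = 1. Proof. exact: normr1. Qed.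
Lemma mob_one_aP : `|0 : C| < 1. Proof. by rewrite normr0. Qed.

Definition mob_one : mob := Mob mob_one_uP mob_one_aP.

Lemma mob_oneE (z : C) : mob_fun mob_one z = z.
Proof. by rewrite /mob_fun /= rmorph0 mul0r !subr0 mul1r divr1. Qed.

Lemma mob_inv_uP (g : mob) : `|(mob_u g)^*| = 1.
Proof. by rewrite norm_conjC mob_uP. Qed.

Lemma mob_inv_aP (g : mob) : `|- (mob_u g * mob_a g)| < 1.
Proof. by rewrite normrN normrM mob_uP mul1r mob_aP. Qed.

Definition mob_inv (g : mob) : mob := Mob (mob_inv_uP g) (mob_inv_aP g).

Lemma mob_invK : involutive mob_inv.
Proof.
move=> g; apply: mob_eq => /=; first exact: conjCK.
by rewrite mulrN opprK mulrA [_^* * _]mulrC mob_u_conj mul1r.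
Qed.

Lemma mob_invE (g : mob) (z : C) : `|z| <= 1 -> mob_fun (mob_inv g) (mob_fun g z) = z.
Proof.
move=> z1; have dg := mob_den_neq0 g z1.
have := mob_den_neq0 (mob_inv g) (mob_fun_disc g z1).
have uu := mob_u_conj g.
have u0 : mob_u g != 0 by rewrite -normr_eq0 mob_uP oner_eq0.
rewrite /mob_fun /= rmorphN rmorphM /=.
have -> : (mob_u g)^* = (mob_u g)^-1 by rewrite -[RHS]mulr1 -uu mulKf.
move=> dd.
have aa : 1 - mob_a g * (mob_a g)^* != 0.
  by rewrite -normCK subr_eq0 eq_sym lt_eqF// expr_lt1// mob_aP.
field; apply/and3P; split => //.
rewrite [X in X != 0](_ : _ = 1 - mob_a g * (mob_a g)^*)//=; ring.
Qed.

Lemma mob_mulA : associative mob_mul.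
Proof.
move=> g h k; apply: mob_fun_inj => z /ltW z1.
by rewrite !mob_mulE// mob_fun_disc.
Qed.

Lemma mob_mul1 : left_id mob_one mob_mul.
Proof. by move=> g; apply: mob_fun_inj => z /ltW z1; rewrite mob_mulE// mob_oneE. Qed.

Lemma mob_mulr1 : right_id mob_one mob_mul.
Proof. by move=> g; apply: mob_fun_inj => z /ltW z1; rewrite mob_mulE// mob_oneE. Qed.

Lemma mob_mulV : left_inverse mob_one mob_inv mob_mul.
Proof.
move=> g; apply: mob_fun_inj => z /ltW z1.
by rewrite mob_mulE// mob_invE// mob_oneE.
Qed.

Lemma mob_mulrV : right_inverse mob_one mob_inv mob_mul.
Proof. by move=> g; rewrite -{1}[g]mob_invK mob_mulV. Qed.

End Mob.

HB.instance Definition _ (R : realType) := gen_eqMixin (mob R).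
HB.instance Definition _ (R : realType) := gen_choiceMixin (mob R).
HB.instance Definition _ (R : realType) := isGroup.Build (mob R)
  (@mob_mulA R) (@mob_mul1 R) (@mob_mulr1 R) (@mob_mulV R) (@mob_mulrV R).

(* the topology of T x D, i.e. that of the Lie group *)
HB.instance Definition _ (R : realType) := Topological.copy (mob R)
  (initial_topology (fun g : mob R => (mob_u g, mob_a g) : R[i]^o * R[i]^o)).

HB.mixin Record CompleteNormedModule_isHilbert (R : realType) H
    & CompleteNormedModule R[i] H := {
  hdot : H -> H -> R[i] ;
  hdot_linearl : forall (y : H) (a : R[i]) (x x' : H),
    hdot (a *: x + x') y = a * hdot x y + hdot x' y ;
  hdot_conj : forall x y : H, hdot y x = (hdot x y)^* ;
  hdot_norm : forall x : H, hdot x x = `|x| ^+ 2 ;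
  hilbert_separable : exists2 D : set H, countable D & dense D
}.

(* complex separable Hilbert spaces *)
#[short(type="hilbertType")]
HB.structure Definition Hilbert (R : realType) :=
  {H of CompleteNormedModule R[i] H & CompleteNormedModule_isHilbert R H}.

(* The product of normed modules carries the sup norm in the library, hence
   an alias for the Hilbert space direct sum. *)
Definition hsum (R : realType) (H1 H2 : hilbertType R) : Type := (H1 * H2)%type.

Section HilbertSum.
Variables (R : realType) (H1 H2 : hilbertType R).
Notation H := (hsum H1 H2).
Notation C := R[i].

HB.instance Definition _ := GRing.Lmodule.copy H (H1 * H2)%type.

Definition hsum_norm (x : H) : C := sqrtC (`|x.1| ^+ 2 + `|x.2| ^+ 2).

Lemma hsum_norm_sqr (x : H) : hsum_norm x ^+ 2 = `|x.1| ^+ 2 + `|x.2| ^+ 2.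
Proof. exact: sqrtCK. Qed.

Lemma hsum_norm_ge0 (x : H) : 0 <= hsum_norm x.
Proof. by rewrite sqrtC_ge0 addr_ge0// exprn_ge0. Qed.

Lemma hsum_normD (x y : H) : hsum_norm (x + y) <= hsum_norm x + hsum_norm y.
Proof.
have hr (z : C) : 0 <= z -> z \is Num.real by exact: ger0_real.
rewrite -(@ler_pXn2r _ 2)// ?nnegrE ?addr_ge0 ?hsum_norm_ge0//.
rewrite sqrrD !hsum_norm_sqr /=.
have cs : `|x.1| * `|y.1| + `|x.2| * `|y.2| <= hsum_norm x * hsum_norm y.
  rewrite -(@ler_pXn2r _ 2)// ?nnegrE ?mulr_ge0 ?addr_ge0 ?hsum_norm_ge0 ?mulr_ge0//.
  rewrite exprMn !hsum_norm_sqr -subr_ge0.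
  rewrite (_ : _ - _ = (`|x.1| * `|y.2| - `|x.2| * `|y.1|) ^+ 2); last by ring.
  by rewrite real_exprn_even_ge0// rpredB// rpredM// hr.
have sq (V : hilbertType R) (u v : V) :
    `|u + v| ^+ 2 <= `|u| ^+ 2 + `|v| ^+ 2 + (`|u| * `|v|) *+ 2.
  rewrite addrAC -sqrrD ler_pXn2r// ?nnegrE ?addr_ge0//; exact: ler_normD.
apply: (le_trans (lerD (sq _ _ _) (sq _ _ _))).
rewrite -subr_ge0 (_ : _ - _ = (hsum_norm x * hsum_norm y
  - (`|x.1| * `|y.1| + `|x.2| * `|y.2|)) *+ 2); last by ring.
by rewrite mulrn_wge0// subr_ge0.
Qed.

Lemma hsum_normZ (l : C) (x : H) : hsum_norm (l *: x) = `|l| * hsum_norm x.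
Proof.
apply/eqP; rewrite -(@eqrXn2 _ 2) ?mulr_ge0 ?hsum_norm_ge0//.
by rewrite exprMn !hsum_norm_sqr !normrZ !exprMn mulrDr.
Qed.

Lemma hsum_norm0_eq0 (x : H) : hsum_norm x = 0 -> x = 0.
Proof.
move=> /eqP; rewrite -sqrf_eq0 hsum_norm_sqr paddr_eq0 ?exprn_ge0//.
by rewrite !sqrf_eq0 !normr_eq0; case: x => ? ? /= /andP[/eqP-> /eqP->].
Qed.

HB.instance Definition _ :=
  Lmodule_isNormed.Build C H hsum_normD hsum_normZ hsum_norm0_eq0.

Lemma hsum_normE (x : H) : `|x| = hsum_norm x. Proof. by []. Qed.

Lemma hsum_norm_fst (x : H) : `|x.1| <= `|x|.
Proof.
rewrite -(@ler_pXn2r _ 2)// ?nnegrE// hsum_normE hsum_norm_sqr.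
by rewrite lerDl exprn_ge0.
Qed.

Lemma hsum_norm_snd (x : H) : `|x.2| <= `|x|.
Proof.
rewrite -(@ler_pXn2r _ 2)// ?nnegrE// hsum_normE hsum_norm_sqr.
by rewrite lerDr exprn_ge0.
Qed.

Lemma hsum_norm_le (x : H) : `|x| <= `|x.1| + `|x.2|.
Proof.
rewrite -(@ler_pXn2r _ 2)// ?nnegrE ?addr_ge0// hsum_normE hsum_norm_sqr sqrrD.
by rewrite addrAC lerDl mulrn_wge0 ?mulr_ge0.
Qed.

Lemma hsum_complete (F : set_system H) : ProperFilter F -> cauchy F -> cvg F.
Proof.
move=> FF /cauchyP Fc.
have c1 : cvg (@fst H1 H2 @ F).
  apply: cauchy_cvg; apply/cauchyP => e e0; have [x Fx] := Fc e e0.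
  exists x.1; apply: (@filterS _ F _ (ball x e)) Fx => y.
  rewrite -!ball_normE /=; apply: le_lt_trans; exact: (hsum_norm_fst (x - y)).
have c2 : cvg (@snd H1 H2 @ F).
  apply: cauchy_cvg; apply/cauchyP => e e0; have [x Fx] := Fc e e0.
  exists x.2; apply: (@filterS _ F _ (ball x e)) Fx => y.
  rewrite -!ball_normE /=; apply: le_lt_trans; exact: (hsum_norm_snd (x - y)).
apply/cvg_ex; exists (lim (@fst H1 H2 @ F), lim (@snd H1 H2 @ F)).
apply/cvgrPdist_lt => e e0.
have e20 : 0 < e / 2 by rewrite divr_gt0.
move/cvgrPdist_lt : c1 => /(_ _ e20) c1.
move/cvgrPdist_lt : c2 => /(_ _ e20) c2.
near=> x.
rewrite (splitr e); apply: le_lt_trans (hsum_norm_le _) _.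
by apply: ltrD => /=; near: x.
Unshelve. all: by end_near. Qed.

HB.instance Definition _ := Uniform_isComplete.Build H hsum_complete.

Definition hsum_dot (x y : H) : C := hdot x.1 y.1 + hdot x.2 y.2.

Lemma hsum_dot_linearl (y : H) (a : C) (x x' : H) :
  hsum_dot (a *: x + x') y = a * hsum_dot x y + hsum_dot x' y.
Proof. by rewrite /hsum_dot !hdot_linearl mulrDr addrACA. Qed.

Lemma hsum_dot_conj (x y : H) : hsum_dot y x = (hsum_dot x y)^*.
Proof. by rewrite rmorphD /= /hsum_dot hdot_conj [in LHS](hdot_conj x.2). Qed.

Lemma hsum_dot_norm (x : H) : hsum_dot x x = `|x| ^+ 2.
Proof. by rewrite hsum_normE hsum_norm_sqr /hsum_dot !hdot_norm. Qed.

Lemma hsum_separable : exists2 D : set H, countable D & dense D.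
Proof.
have [D1 cD1 dD1] := @hilbert_separable R H1.
have [D2 cD2 dD2] := @hilbert_separable R H2.
exists (D1 `*` D2); first exact: countableX.
move=> O [x Ox] oO.
have /nbhs_ballP[e /= e0 sO] : nbhs x O by exact: open_nbhs_nbhs.
have e20 : 0 < e / 2 by rewrite divr_gt0.
have [u [xu Du]] : ball x.1 (e / 2) `&` D1 !=set0.
  apply: dD1; first by exists x.1; exact: ballxx.
  exact: ball_open.
have [v [xv Dv]] : ball x.2 (e / 2) `&` D2 !=set0.
  apply: dD2; first by exists x.2; exact: ballxx.
  exact: ball_open.
exists (u, v); split => //; apply: sO; rewrite -!ball_normE /= in xu xv *.
rewrite (splitr e); apply: le_lt_trans (hsum_norm_le _) _.
exact: ltrD xu xv.
Qed.

HB.instance Definition _ := CompleteNormedModule_isHilbert.Build R H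
  hsum_dot_linearl hsum_dot_conj hsum_dot_norm hsum_separable.

End HilbertSum.

Section Operators.
Variable R : realType.
Implicit Types H K : hilbertType R.

Definition bounded_op H K (A : H -> K) : Prop := linear A /\ continuous A.

(* meaningful when an adjoint exists, which is then unique *)
Definition adjoint H K (A : H -> K) : K -> H :=
  xget (fun=> 0) [set B | forall x y, hdot (A x) y = hdot x (B y)].

Definition is_unitary H K (U : H -> K) : Prop :=
  [/\ linear U, (forall x y, hdot (U x) (U y) = hdot x y)
    & forall y, exists x, U x = y].

Definition is_op_inverse H (A B : H -> H) : Prop :=
  [/\ bounded_op B, cancel A B & cancel B A].

Definition invertible_op H (A : H -> H) : Prop := exists B, is_op_inverse A B.

(* meaningful when A is invertible *)
Definition op_inv H (A : H -> H) : H -> H := xget (fun x : H => x) (is_op_inverse A).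

Definition spectrum H (A : H -> H) : set R[i] :=
  [set z | ~ invertible_op (fun x => A x - z *: x)].

(* u (A - a) (1 - a^* A)^-1, for g = u (z - a) / (1 - a^* z) *)
Definition mob_op H (g : mob R) (A : H -> H) : H -> H := fun x =>
  let y := op_inv (fun v => v - (mob_a g)^* *: A v) x in
  mob_u g *: (A y - mob_a g *: y).

Definition unitarily_equivalent H K (A : H -> H) (B : K -> K) : Prop :=
  exists U : H -> K, is_unitary U /\ A =1 adjoint U \o B \o U.

Definition homogeneous H (A : H -> H) : Prop :=
  [/\ bounded_op A, spectrum A `<=` [set z | `|z| <= 1]
    & forall g : mob R, unitarily_equivalent (mob_op g A) A].

Definition borel_map (X Y : topologicalType) (f : X -> Y) : Prop :=
  forall B : set Y, <<s [set O : set Y | open O] >> B ->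
    <<s [set O : set X | open O] >> (f @^-1` B).

(* {ptws H -> H} is the topology of pointwise convergence: it induces the
   strong operator topology on the unitary group. *)
Definition proj_rep H (pi : mob R -> H -> H) : Prop :=
  [/\ forall g, is_unitary (pi g),
      borel_map (pi : mob R -> {ptws H -> H}),
      forall x, pi 1%g x = x
    & exists m : mob R * mob R -> R[i]^o,
      [/\ borel_map m, forall gh, `|m gh| = 1
        & forall g h x, pi (g * h)%g x = m (g, h) *: pi g (pi h x)]].

Definition associated H (pi : mob R -> H -> H) (A : H -> H) : Prop :=
  forall g, mob_op g A =1 adjoint (pi g) \o A \o pi g.

Definition rep_sum H K (pi : mob R -> H -> H) (rho : mob R -> K -> K)
    (g : mob R) (x : hsum H K) : hsum H K :=
  (pi g x.1, rho g x.2).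

(* the block matrix [A 0; S B] *)
Definition lower_block H K (A : H -> H) (S : H -> K) (B : K -> K)
    (x : hsum H K) : hsum H K :=
  (A x.1, S x.1 + B x.2).

Definition orthogonal_basis (I : Type) H (e : I -> H) : Prop :=
  [/\ forall i, e i <> 0,
      forall i j, i <> j -> hdot (e i) (e j) = 0
    & forall x, (forall i, hdot x (e i) = 0) -> x = 0].

Definition coord (I : Type) H (e : I -> H) (x : H) (i : I) : R[i] :=
  hdot x (e i) / hdot (e i) (e i).

End Operators.

Section Series.
Variable R : realType.
Implicit Types (H : hilbertType R) (g : mob R).
Notation C := R[i].

Definition mob_der g (z : C) : C :=
  mob_u g * (1 - `|mob_a g| ^+ 2) / (1 - (mob_a g)^* * z) ^+ 2.

Definition mob_der_log g (z : C) : C :=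
  (ln (1 - cabs (mob_a g) ^+ 2) +i* carg (mob_u g))%C
  - 2 * cln (1 - (mob_a g)^* * z).

(* g'(z) ^ s *)
Definition mob_der_pow g (s z : C) : C := cexp (s * mob_der_log g z).

(* g'(z) ^ (lambda / 2) * |g'(z)| ^ mu *)
Definition Rweight (lambda : R) (mu : C) g (z : C) : C :=
  mob_der_pow g (lambda / 2)%:C%C z * cexp (mu * (ln (cabs (mob_der g z)))%:C%C).

(* expi maps it bijectively onto the circle *)
Definition period : set R := `]-pi, pi].

Definition L2_circle (f : C -> C) : Prop :=
  [/\ measurable_fun period (fun t : R => complex.Re (f (expi t))),
      measurable_fun period (fun t : R => complex.Im (f (expi t)))
    & (\int[lebesgue_measure]_(t in period) (cabs (f (expi t)) ^+ 2)%:E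
       < +oo)%E].

Definition fourier_coef (f : C -> C) (n : int) : C :=
  let k (t : R) : C := f (expi t) * expi (- n%:~R * t) in
  ((2 * pi)^-1)%:C%C *
  ((\int[lebesgue_measure]_(t in period) complex.Re (k t))%R
   +i* (\int[lebesgue_measure]_(t in period) complex.Im (k t))%R)%C.

(* The Hilbert spaces of functions on the circle with orthogonal basis
   (z ^ n)_n are given by their basis e, e n being the function z ^ n. Their
   weights `|e n| ^ 2 are at most 1, hence L^2 of the circle is contained in
   such a space (and is equal to it when all the weights are 1):
   circle_vec e x f states that the vector x is the function f of L^2. *)
Definition circle_vec H (e : int -> H) (x : H) (f : C -> C) : Prop :=
  L2_circle f /\ forall n, coord e x n = fourier_coef f n.

(* L^2 is dense, hence this determines the bounded operators pi g^-1. *)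
Definition circle_rep (lambda : R) (mu : C) H (e : int -> H)
    (pi : mob R -> H -> H) : Prop :=
  forall g x f, circle_vec e x f ->
    circle_vec e (pi g^-1%g x)
      (fun z => Rweight lambda mu g z * f (mob_fun g z)).

Definition principal_series (lambda : R) (s : C) H (e : int -> H)
    (pi : mob R -> H -> H) : Prop :=
  [/\ -1 < lambda <= 1, complex.Re s = 0, orthogonal_basis e,
      forall n, `|e n| = 1
    & circle_rep lambda (((1 - lambda) / 2)%:C%C + s) e pi].

Definition complementary_weight (lambda sigma : R) (n : int) : R :=
  let l := if 0 <= n then lambda else - lambda in
  \prod_(k < `|n|%N) ((k%:R + l / 2 + 1 / 2 - sigma) /
                      (k%:R + l / 2 + 1 / 2 + sigma)).

Definition complementary_series (lambda sigma : R) H (e : int -> H)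
    (pi : mob R -> H -> H) : Prop :=
  [/\ -1 < lambda < 1, 0 < sigma < (1 - `|lambda|) / 2, orthogonal_basis e,
      forall n, `|e n| ^+ 2 = (complementary_weight lambda sigma n)%:C%C
    & circle_rep lambda ((1 - lambda) / 2 + sigma)%:C%C e pi].

(* H^(nu), e n being the function z ^ n *)
Definition disc_space (nu : R) H (e : nat -> H) : Prop :=
  orthogonal_basis e /\
  forall n, `|e n| ^+ 2 = (Gamma n.+1%:R * Gamma nu / Gamma (n%:R + nu))%:C%C.

(* x is the function f on the open unit disc *)
Definition disc_vec H (e : nat -> H) (x : H) (f : C -> C) : Prop :=
  forall z : C, `|z| < 1 ->
    (series (fun n => coord e x n * z ^+ n) : nat -> R[i]^o) @ \oo
      --> (f z : R[i]^o).

Definition discrete_plus (nu : R) H (e : nat -> H) (pi : mob R -> H -> H) :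
    Prop :=
  [/\ 0 < nu, disc_space nu e
    & forall g x f, disc_vec e x f ->
        disc_vec e (pi g^-1%g x)
          (fun z => Rweight nu 0 g z * f (mob_fun g z))].

Definition discrete_minus (nu : R) H (e : nat -> H) (pi : mob R -> H -> H) :
    Prop :=
  [/\ 0 < nu, disc_space nu e
    & forall g x f, disc_vec e x f ->
        disc_vec e (pi g^-1%g x)
          (fun z => (mob_der_pow g (nu / 2)%:C%C z^*)^* *
                    f (mob_fun g z^*)^*)].

End Series.

(* Main.v *)
(* The resolvent being a genuine inverse, the association relation
   phi(T) = pi(phi)^* T pi(phi) unfolds to
   u (pi T - a pi) = T pi - a^* T pi T, whose (2,1) block is the first claim.

   For the second claim, rotations show that S2 and T1 raise by one the weight
   of a vector: T1 e_n = t_n e_(n+1), and the vectors S2 e_n are pairwise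
   orthogonal.  For phi(z) = (z - t) / (1 - t z) with t real, the function
   pi1(phi) z^n is
     z^n + t ((n - mu) z^(n-1) - (lambda + mu + n) z^(n+1)) + O(t^2)
   uniformly on the circle.  If S2 e_n = 0, then the (2,1) relation gives
   S2 (pi1(phi) (e_n - t T1 e_n)) = 0; testing against S2 e_(n-1) and
   S2 e_(n+1) at first order in t yields (n - mu) S2 e_(n-1) = 0 and
   (lambda + mu + n + t_n) S2 e_(n+1) = 0.  Outside P_(1,0) neither mu nor
   lambda + mu is an integer, and the (1,1) relation at first order,
   t_n (lambda + mu + n + 1) = t_(n+1) (lambda + mu + n) + t_n t_(n+1),
   excludes lambda + mu + n + t_n = 0.  Hence the vanishing of one S2 e_n
   propagates to all n.  The start is n = m - 2: by weights S2 e_(m-1) lies in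
   the D^+ summand, which T2 preserves, whereas S2 e_(m-2) lies in D^-, so the
   same first-order argument kills S2 e_(m-2). *)

Require Import Defs.
From mathcomp Require Import all_boot all_order all_algebra.
From mathcomp Require Import all_classical all_reals all_analysis.
From mathcomp Require Import complex.
From mathcomp Require Import measurable_realfun ring lra zify.
Import Order.TTheory GRing.Theory Num.Theory.
Import numFieldNormedType.Exports.

Set Implicit Arguments.
Unset Strict Implicit.

Local Open Scope classical_set_scope.
Local Open Scope ring_scope.

Local Notation coord := Defs.coord.
Local Notation is_unitary := Defs.is_unitary.

(** * Elementary real estimates *)

Section RealEstimates.
Variable R : realType.
(** Both signs of [x] are covered at once. Applied to [sin y - y] or [atan y - y], it turns a bound
    on the derivative into a remainder estimate. *)
Lemma MVT_from0 (f df : R -> R) (x : R) : (forall y : R, is_derive y 1 f (df y)) -> f 0 = 0 ->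
  exists2 c : R, `|c| <= `|x| & f x = df c * x.
Proof.
move=> d f0.
have cf a b : {within `[a, b], continuous f}.
  apply: continuous_subspaceT => y; apply: differentiable_continuous.
  by apply/derivable1_diffP; have [] := d y.
have [x0|x0|<-] := ltgtP 0 x; last first.
- by exists 0; rewrite ?mulr0// f0.
- have [c cx e] := MVT_segment (ltW x0) (fun y _ => d y) (cf _ _).
  exists c; move: cx; rewrite in_itv/= => /andP[h1 h2].
    by rewrite ler0_norm// ltr0_norm// lerN2.
  by move: e; rewrite f0 !sub0r; lra.
- have [c cx e] := MVT_segment (ltW x0) (fun y _ => d y) (cf _ _).
  exists c; move: cx; rewrite in_itv/= => /andP[h1 h2].
    by rewrite ger0_norm// gtr0_norm.
  by move: e; rewrite f0 !subr0.
Qed.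

Lemma norm_sin_le (x : R) : `|sin x| <= `|x|.
Proof.
have [c _ ->] := @MVT_from0 sin cos x (fun y => is_derive_sin y) (sin0 R).
rewrite normrM ler_piMl//; exact: cos_max.
Qed.

Lemma norm_cosB1_le (x : R) : `|cos x - 1| <= x ^+ 2 / 2.
Proof.
have h := norm_sin_le (x / 2).
have -> : cos x - 1 = - 2 * sin (x / 2) ^+ 2.
  by rewrite [in LHS](_ : x = x / 2 *+ 2) ?cos2_sin2 ?cos_mulr2n; [rewrite cos2sin2; ring | rewrite -mulr_natr; field].
rewrite normrM normrN normrX normr_nat.
have : `|sin (x / 2)| ^+ 2 <= `|x / 2| ^+ 2 by rewrite ler_pXn2r// nnegrE.
rewrite (real_normK (x:=x/2)) ?num_real//; lra.
Qed.

Lemma norm_sinB_le (x : R) : `|sin x - x| <= `|x| ^+ 3.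
Proof.
have [c cx ->] := @MVT_from0 (fun y => sin y - y) (fun y => cos y - 1) x
  (fun y => is_deriveB _ _) ltac:(by rewrite /= sin0 subr0).
rewrite normrM exprSr ler_wpM2r//.
apply: (le_trans (norm_cosB1_le c)).
have : `|c| ^+ 2 <= `|x| ^+ 2 by rewrite ler_pXn2r// nnegrE.
rewrite (real_normK (x:=c)) ?num_real//.
have := sqr_ge0 c; lra.
Qed.

Lemma norm_atanB_le (x : R) : `|atan x - x| <= `|x| ^+ 3.
Proof.
have [c cx ->] := @MVT_from0 (fun y => atan y - y) (fun y => (1 + y ^+ 2)^-1 - 1) x
  (fun y => is_deriveB _ _) ltac:(by rewrite /= atan0 subr0).
rewrite normrM [_ ^+ 3]exprSr ler_wpM2r//.
have : `|c| ^+ 2 <= `|x| ^+ 2 by rewrite ler_pXn2r// nnegrE.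
rewrite (real_normK (x:=c)) ?num_real//; apply: le_trans.
have c0 : 0 < 1 + c ^+ 2 by have := sqr_ge0 c; lra.
rewrite (_ : _ - 1 = - (c ^+ 2 / (1 + c ^+ 2))); last first.
  by field; rewrite gt_eqF.
have q0 : 0 <= c ^+ 2 / (1 + c ^+ 2) by rewrite divr_ge0 ?sqr_ge0// ltW.
rewrite normrN (ger0_norm q0) ler_pdivrMr//.
have := sqr_ge0 c; nra.
Qed.

(** The inequality [1 + y <= expR y] at [y = x] and at [y = - x] squeezes [expR x] between [1 + x]
    and [1 / (1 - x)]. *)
Lemma norm_expRB1B_le (x : R) : `|x| <= 1 / 2 -> `|expR x - 1 - x| <= 2 * x ^+ 2.
Proof.
rewrite ler_norml => /andP[x1 x2].
have h1 := expR_ge1Dx x; have h2 := expR_ge1Dx (- x).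
have h3 : expR x * expR (- x) = 1 by rewrite -expRD subrr expR0.
have h4 := expR_gt0 x.
rewrite ger0_norm; last lra.
have : expR x * (1 - x) <= expR x * expR (- x) by rewrite ler_pM2l.
rewrite h3.
have := sqr_ge0 x; nra.
Qed.

(** The upper bound [ln (1 + x) <= x], used again at [1 / (1 + x) = 1 - x / (1 + x)], gives the
    lower bound [x / (1 + x)]. *)
Lemma norm_lnB_le (x : R) : `|x| <= 1 / 2 -> `|ln (1 + x) - x| <= 2 * x ^+ 2.
Proof.
rewrite ler_norml => /andP[x1 x2].
have h1 : ln (1 + x) <= x by apply: le_ln1Dx; lra.
have x0 : 0 < 1 + x by lra.
have e : (1 + x)^-1 = 1 + (- (x / (1 + x))) by field; rewrite gt_eqF.
have h2 : ln (1 + (- (x / (1 + x)))) <= - (x / (1 + x)).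
  by apply: le_ln1Dx; rewrite -subr_gt0 opprK addrC -e invr_gt0.
move: h2; rewrite -e lnV ?posrE// lerN2 => h2.
rewrite ler0_norm; last lra.
rewrite opprB lerBlDr -lerBlDl; apply: le_trans h2.
rewrite ler_pdivlMr//; have := sqr_ge0 x; nra.
Qed.
End RealEstimates.

(** * Modulus, exponential and argument *)

Section ComplexExponential.
Variable R : realType.
Notation C := R[i].
Implicit Types (z w : C) (x y : R).

Lemma cabsE z : `|z| = (cabs z)%:C%C. Proof. by []. Qed.

Lemma complex_eq z w : complex.Re z = complex.Re w -> complex.Im z = complex.Im w -> z = w.
Proof. by case: z w => a b [c d] /= -> ->. Qed.

Lemma cabs_ge0 z : 0 <= cabs z.
Proof. by rewrite -lecR -cabsE; exact: normr_ge0. Qed.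

Lemma cabsM z w : cabs (z * w) = cabs z * cabs w.
Proof. by apply: complexI; rewrite rmorphM /= -!cabsE normrM. Qed.

Lemma cabsN z : cabs (- z) = cabs z.
Proof. by apply: complexI; rewrite -!cabsE normrN. Qed.

Lemma cabsJ z : cabs z^* = cabs z.
Proof. by apply: complexI; rewrite -!cabsE norm_conjC. Qed.

Lemma cabsV z : cabs z^-1 = (cabs z)^-1.
Proof. by apply: complexI; rewrite fmorphV /= -!cabsE normfV. Qed.

Lemma cabsX z n : cabs (z ^+ n) = cabs z ^+ n.
Proof. by apply: complexI; rewrite rmorphXn /= -!cabsE normrX. Qed.

Lemma cabs1 : cabs (1 : C) = 1.
Proof. by apply: complexI; rewrite -!cabsE normr1. Qed.

Lemma cabs0 : cabs (0 : C) = 0.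
Proof. by apply: complexI; rewrite -!cabsE normr0. Qed.

Lemma cabsR x : cabs x%:C%C = `|x|.
Proof. by rewrite /cabs normc_def /= expr0n /= addr0 sqrtr_sqr. Qed.

Lemma cabs_eq0 z : (cabs z == 0) = (z == 0).
Proof. by rewrite -(inj_eq (@complexI R)) -cabsE normr_eq0. Qed.

Lemma ler_cabsD z w : cabs (z + w) <= cabs z + cabs w.
Proof. by rewrite -lecR rmorphD /= -!cabsE ler_normD. Qed.

Lemma sqr_cabs z : cabs z ^+ 2 = complex.Re z ^+ 2 + complex.Im z ^+ 2.
Proof. by apply: complexI; rewrite rmorphXn /= -cabsE -add_Re2_Im2. Qed.

Lemma ler_Re_cabs z : `|complex.Re z| <= cabs z.
Proof. by rewrite -lecR -cabsE normc_ge_Re. Qed.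

Lemma ler_Im_cabs z : `|complex.Im z| <= cabs z.
Proof.
rewrite -(@ler_pXn2r _ 2)// ?nnegrE ?cabs_ge0// sqr_cabs real_normK ?num_real//.
by rewrite lerDr sqr_ge0.
Qed.

Lemma ler_cabs z : cabs z <= `|complex.Re z| + `|complex.Im z|.
Proof.
rewrite -(@ler_pXn2r _ 2)// ?nnegrE ?cabs_ge0 ?addr_ge0// sqr_cabs.
rewrite sqrrD !real_normK ?num_real// addrAC lerDl mulrn_wge0// mulr_ge0//.
Qed.

Lemma cexpD z w : cexp (z + w) = cexp z * cexp w.
Proof.
case: z w => a b [c d]; rewrite /cexp /= expRD cosD sinD.
by apply: complex_eq => /=; ring.
Qed.

Lemma cexp0 : cexp (0 : C) = 1.
Proof. by rewrite /cexp /= expR0 cos0 sin0 mul1r. Qed.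

Lemma cexp_neq0 z : cexp z != 0.
Proof.
apply/eqP => e; have := cexpD z (- z).
by rewrite subrr cexp0 e mul0r => /eqP; rewrite oner_eq0.
Qed.

Lemma cexpN z : cexp (- z) = (cexp z)^-1.
Proof.
by apply: (mulfI (cexp_neq0 z)); rewrite -cexpD subrr cexp0 divff// cexp_neq0.
Qed.

Lemma cexpM_nat (n : nat) z : cexp (n%:R * z) = cexp z ^+ n.
Proof.
elim: n => [|n IH]; first by rewrite mul0r cexp0.
by rewrite -natr1 mulrDl mul1r cexpD IH exprSr.
Qed.

Lemma cexpM_int (n : int) z : cexp (n%:~R * z) = cexp z ^ n.
Proof.
case: n => n; first by rewrite -pmulrn cexpM_nat.
by rewrite NegzE mulrNz mulNr cexpN -pmulrn cexpM_nat.
Qed.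

Lemma cexp_conj z : cexp z^* = (cexp z)^*.
Proof.
case: z => a b; apply: complex_eq => /=; rewrite /cexp/= ?cosN ?sinN; ring.
Qed.

Lemma cos_carg z : z != 0 -> cos (carg z) = complex.Re z / cabs z.
Proof.
move=> z0; have r0 : 0 < cabs z by rewrite lt_def cabs_eq0 z0 cabs_ge0.
have q : -1 <= complex.Re z / cabs z <= 1.
  by rewrite -ler_norml normrM normfV (gtr0_norm r0) ler_pdivrMr// mul1r ler_Re_cabs.
by rewrite /carg; case: ifP => _; rewrite ?cosN acosK// in_itv.
Qed.

Lemma sin_carg z : z != 0 -> sin (carg z) = complex.Im z / cabs z.
Proof.
move=> z0; have r0 : 0 < cabs z by rewrite lt_def cabs_eq0 z0 cabs_ge0.
have q : -1 <= complex.Re z / cabs z <= 1.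
  by rewrite -ler_norml normrM normfV (gtr0_norm r0) ler_pdivrMr// mul1r ler_Re_cabs.
have e : sin (acos (complex.Re z / cabs z)) = `|complex.Im z| / cabs z.
  rewrite sin_acos// (_ : 1 - _ = (complex.Im z / cabs z) ^+ 2).
    by rewrite sqrtr_sqr normrM normfV (gtr0_norm r0).
  apply: (@mulIf _ (cabs z ^+ 2)); first by rewrite expf_neq0// gt_eqF.
  rewrite mulrBl -!exprMn !mulfVK ?gt_eqF// sqr_cabs; ring.
rewrite /carg; case: ifPn => [h|]; first by rewrite e ger0_norm.
by rewrite -ltNge => h; rewrite sinN e ltr0_norm// mulNr opprK.
Qed.

Lemma cexp_cln z : z != 0 -> cexp (cln z) = z.
Proof.
move=> z0; have r0 : 0 < cabs z by rewrite lt_def cabs_eq0 z0 cabs_ge0.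
rewrite /cexp /= lnK ?posrE// cos_carg// sin_carg//.
by apply: complex_eq => /=; field; rewrite gt_eqF.
Qed.

(** The [acos] in [carg] is singular at the positive reals, whereas [atan] is smooth there;
    estimating the logarithm near 1 requires the latter. *)
Lemma carg_atan z : 0 < complex.Re z -> carg z = atan (complex.Im z / complex.Re z).
Proof.
move=> x0; set x := complex.Re z in x0 *; set y := complex.Im z.
have z0 : z != 0 by apply: contraTneq x0 => e; rewrite /x e ltxx.
have r0 : 0 < cabs z by rewrite lt_def cabs_eq0 z0 cabs_ge0.
have c s : cos (atan s) = (Num.sqrt (1 + s ^+ 2))^-1 by rewrite cos_atan.
have e : x / cabs z = cos (atan (y / x)).
  rewrite c (_ : 1 + _ = (cabs z / x) ^+ 2); last first.
    by rewrite !expr_div_n sqr_cabs -/x -/y; field; rewrite gt_eqF.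
  by rewrite sqrtr_sqr ger0_norm ?divr_ge0// ?ltW// invf_div.
have [hl hu] := (atan_gtNpi2 (y / x), atan_ltpi2 (y / x)).
have p0 := pi_gt0 R.
rewrite /carg -/x -/y e; case: ifPn => [y0|].
  rewrite cosK// in_itv/=.
  have : 0 <= atan (y / x) by rewrite -atan0 le_atan// divr_ge0// ltW.
  by move=> ->/=; lra.
rewrite -ltNge => y0; rewrite -cosN cosK ?opprK// in_itv/=.
have : atan (y / x) <= 0 by rewrite -atan0 le_atan// ler_pdivrMr// mul0r ltW.
move=> h; apply/andP; split; lra.
Qed.

End ComplexExponential.

(** * Second-order remainders of the complex exponential and logarithm *)

Section ComplexEstimates.
Variable R : realType.
Notation C := R[i].
Implicit Types (z w : C) (x y t : R).

Lemma cabs_cexpB1B_le w : cabs w <= 1 / 2 -> cabs (cexp w - 1 - w) <= 8 * cabs w ^+ 2.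
Proof.
set r := cabs w => r2; have r0 : 0 <= r by exact: cabs_ge0.
have rx := ler_Re_cabs w; have ry := ler_Im_cabs w.
case: w @r r2 r0 rx ry => x y r r2 r0 /=; rewrite -/r => rx ry.
have e1 := norm_expRB1B_le (le_trans rx r2).
have x2 : x ^+ 2 <= r ^+ 2 by rewrite -(real_normK (x:=x)) ?num_real// ler_pXn2r// nnegrE.
have y2 : y ^+ 2 <= r ^+ 2 by rewrite -(real_normK (x:=y)) ?num_real// ler_pXn2r// nnegrE.
have rr : r ^+ 2 <= 1 / 4 by nra.
have e2 := norm_cosB1_le y.
have e3 : `|sin y - y| <= r ^+ 2.
  apply: (le_trans (norm_sinB_le y)).
  have : `|y| ^+ 3 <= r ^+ 3 by rewrite ler_pXn2r// nnegrE.
  move/le_trans; apply; rewrite exprSr; nra.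
have ex0 := expR_gt0 x.
have ex2 : expR x <= 2.
  move: e1 rx; rewrite !ler_norml => /andP[_ h] /andP[_ h']; lra.
have ex1 : `|expR x - 1| <= 2 * r.
  have -> : expR x - 1 = (expR x - 1 - x) + x by ring.
  apply: (le_trans (ler_normD _ _)); nra.
apply: (le_trans (ler_cabs _)).
(* Up to the bounded factor [expR x], each summand is a real second-order remainder or a product of
   two first-order quantities. *)
rewrite (_ : complex.Re _ = (expR x - 1 - x) + expR x * (cos y - 1)); last first.
  by rewrite /cexp /=; ring.
rewrite (_ : complex.Im _ = expR x * (sin y - y) + (expR x - 1) * y); last first.
  by rewrite /cexp /=; ring.
have a1 : `|expR x * (cos y - 1)| <= r ^+ 2.
  rewrite normrM gtr0_norm//; have := normr_ge0 (cos y - 1); nra.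
have a2 : `|expR x * (sin y - y)| <= 2 * r ^+ 2.
  rewrite normrM gtr0_norm//; have := normr_ge0 (sin y - y); nra.
have a3 : `|(expR x - 1) * y| <= 2 * r ^+ 2.
  rewrite normrM expr2 mulrA ler_pM//.
have := ler_normD (expR x - 1 - x) (expR x * (cos y - 1)).
have := ler_normD (expR x * (sin y - y)) ((expR x - 1) * y).
have := sqr_ge0 r; lra.
Qed.

Lemma cabs_clnB_le w : cabs w <= 1 / 8 -> cabs (cln (1 + w) - w) <= 10 * cabs w ^+ 2.
Proof.
set r := cabs w => r2; have r0 : 0 <= r by exact: cabs_ge0.
have rx := ler_Re_cabs w; have ry := ler_Im_cabs w.
have rxy := sqr_cabs w.
case: w @r r2 r0 rx ry rxy => u v r r2 r0 /=; rewrite -/r => ru rv ruv.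
have rr : 0 <= r ^+ 2 by rewrite sqr_ge0.
have [u1 u2] : - r <= u /\ u <= r by move: ru; rewrite ler_norml => /andP[].
have u0 : 0 < 1 + u by lra.
apply: (le_trans (ler_cabs _)).
set w1 := (1 + _ : C).
have c0 : 0 < cabs w1.
  rewrite lt_def cabs_ge0 andbT cabs_eq0; apply: contraTneq u0 => /(congr1 (@complex.Re R))/= ->.
  by rewrite ltxx.
(* The squared modulus is [1 + (2 * u + r ^+ 2)], so the real estimate for [ln] applies without a
   square root. *)
have e1 : 2 * ln (cabs w1) = ln (1 + (2 * u + r ^+ 2)).
  rewrite mulr_natl -lnXn// sqr_cabs /= add0r; congr ln; rewrite ruv; ring.
have s1 : `|2 * u + r ^+ 2| <= 1 / 2 by rewrite ler_norml; apply/andP; split; nra.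
have h1 : `|ln (cabs w1) - u| <= 7 * r ^+ 2.
  have := norm_lnB_le s1; rewrite -e1.
  have : (2 * u + r ^+ 2) ^+ 2 <= 6 * r ^+ 2.
    rewrite -(real_normK (x := 2 * u + r ^+ 2)) ?num_real//.
    have : `|2 * u + r ^+ 2| <= 9 / 4 * r by rewrite ler_norml; apply/andP; split; nra.
    have := normr_ge0 (2 * u + r ^+ 2); nra.
  rewrite !ler_norml => hh /andP[h h']; apply/andP; split; lra.
have h2 : `|carg w1 - v| <= 3 * r ^+ 2.
  rewrite carg_atan//= add0r; set q := v / (1 + u).
  have q2 : `|q| <= 8 / 7 * r.
    rewrite normrM normfV (gtr0_norm u0) ler_pdivrMr//.
    apply: (le_trans rv); nra.
  (* The first term is cubic in [q]; the second is exactly [q - v] and is quadratic. *)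
  have -> : atan q - v = (atan q - q) + - (u * q) by rewrite /q; field; rewrite gt_eqF.
  apply: (le_trans (ler_normD _ _)); rewrite normrN normrM.
  have a1 := norm_atanB_le q.
  have a2 : `|u| * `|q| <= r * (8 / 7 * r) by rewrite ler_pM.
  have a3 : `|q| ^+ 3 <= (8 / 7 * r) ^+ 3 by rewrite ler_pXn2r// nnegrE//; lra.
  have a4 : (8 / 7 * r) ^+ 3 <= r ^+ 2.
    by rewrite (_ : _ ^+ 3 = 512 / 343 * r * r ^+ 2); [rewrite ler_piMl//; lra | field].
  move: a2; rewrite mulrCA -expr2; lra.
apply: (le_trans (lerD h1 h2)); lra.
Qed.

End ComplexEstimates.

(** * First-order expansion of the multiplier *)

Section Multiplier.
Variable R : realType.
Notation C := R[i].
Implicit Types (z w mu : C) (x y t lambda : R).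

Lemma conj_real_complex x : (x%:C%C)^* = x%:C%C.
Proof. exact: conjc_real. Qed.

Lemma carg1 : carg (1 : C) = 0.
Proof. by rewrite carg_atan /= ?mul0r ?atan0// ltr01. Qed.

(* On the circle |phi'| = (1 - t^2) / |1 + t z|^2 and
   phi = z (1 + t z)^* / (1 + t z), so that everything is the exponential of a
   combination of log (1 + t z) and its conjugate. *)
Lemma RweightE lambda mu (n : int) (g : mob R) t z :
  mob_u g = 1 -> mob_a g = (- t)%:C%C -> 0 < t < 1 -> cabs z = 1 ->
  let l := cln (1 + t%:C%C * z) in
  Rweight lambda mu g z * mob_fun g z ^ n =
  z ^ n * cexp (((lambda / 2)%:C%C + mu) * (ln (1 - t ^+ 2))%:C%C
    - (lambda%:C%C + mu + n%:~R) * l + (n%:~R - mu) * l^* ).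
Proof.
move=> gu ga /andP[t0 t1] z1 l.
have zz : z * z^* = 1 by rewrite -normCK cabsE z1 expr1n.
have w0 : 1 + t%:C%C * z != 0.
  have := mob_den_neq0 g (z := z); rewrite ga cabsE z1 => /(_ (lexx _)).
  by rewrite conj_real_complex rmorphN mulNr opprK.
have z0 : z != 0 by rewrite -cabs_eq0 z1 oner_eq0.
have tt : 0 < 1 - t ^+ 2 by nra.
have r0 : 0 < cabs (1 + t%:C%C * z) by rewrite lt_def cabs_eq0 w0 cabs_ge0.
have ga' : 1 - (mob_a g)^* * z = 1 + t%:C%C * z.
  by rewrite ga conj_real_complex rmorphN mulNr opprK.
have El : cexp l = 1 + t%:C%C * z by exact: cexp_cln.
have fE : mob_fun g z = z * cexp (l^* - l).
  rewrite /mob_fun ga' gu ga cexpD cexpN cexp_conj El mul1r mulrA; congr (_ / _).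
  by rewrite rmorphD rmorph1 rmorphM /= conj_real_complex rmorphN /= opprK mulrDr mulr1 mulrCA zz mulr1.
have lE : mob_der_log g z = (ln (1 - t ^+ 2))%:C%C - 2 * l.
  by rewrite /mob_der_log ga' gu carg1 ga cabsR normrN real_normK ?num_real.
have dE : (ln (cabs (mob_der g z)))%:C%C = (ln (1 - t ^+ 2))%:C%C - (l + l^* ).
  rewrite /mob_der ga' gu mul1r cabsM cabsV cabsX ga cabsE cabsR normrN -rmorphXn.
  rewrite -[1]/(1%:C%C) -rmorphB real_normK ?num_real// cabsR (gtr0_norm tt).
  rewrite ln_div ?posrE ?exprn_gt0// lnXn// rmorphB; congr (_ - _).
  by apply: complex_eq => /=; rewrite ?mulr2n//; ring.
rewrite /Rweight /mob_der_pow fE lE dE expfzMl.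
rewrite mulrCA -cexpM_int -!cexpD; congr (_ * cexp _).
  rewrite [lambda%:C%C](_ : _ = (lambda / 2)%:C%C * 2); first by ring.
  by apply: complex_eq => /=; field.
Qed.

(** By [RweightE] the exponent is [t * (B * z^* - A * z)] up to O(t^2), and [z^*] is the inverse of
    [z] on the circle. The constant is chosen before [g], [t] and [z], so the estimate is
    uniform. *)
Lemma Rweight_expansion lambda mu (n : int) : exists2 K : R, 1 < K &
  forall (g : mob R) t z,
  mob_u g = 1 -> mob_a g = (- t)%:C%C -> 0 < t -> t * K < 1 -> cabs z = 1 ->
  cabs (Rweight lambda mu g z * mob_fun g z ^ n -
    (z ^ n + t%:C%C * ((n%:~R - mu) * z ^ (n - 1)
                 - (lambda%:C%C + mu + n%:~R) * z ^ (n + 1)))) <= K * t ^+ 2.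
Proof.
set A := lambda%:C%C + mu + n%:~R; set B := n%:~R - mu.
set D := (lambda / 2)%:C%C + mu.
have [[A0 B0] D0] := ((cabs_ge0 A, cabs_ge0 B), cabs_ge0 D).
(* [M * t ^+ 2] bounds the error in linearizing the exponent (2 from [ln (1 - t ^+ 2)], 10 from
   [cln]) and [L * t] the exponent. In the witness, 8 and [2 * L] force [t < 1 / 8] and
   [t * L <= 1 / 2]; [8 * L ^+ 2 + M] is the final error. *)
pose M := 2 * cabs D + 10 * (cabs A + cabs B).
pose L := cabs A + cabs B + M.
exists (8 + 2 * L + 8 * L ^+ 2 + M); first by rewrite /L /M; have := sqr_ge0 (cabs A + cabs B + M); rewrite /L /M; lra.
move=> g t z gu ga t0 tK z1.
have M0 : 0 <= M by rewrite /M; lra.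
have L0 : M <= L by rewrite /L; lra.
have LL := sqr_ge0 L.
have t8 : t < 1 / 8 by nra.
have t2 : 0 <= t ^+ 2 <= 1 / 64 by rewrite sqr_ge0 /=; nra.
move: t2 => /andP[t20 t2].
have tL : t * L <= 1 / 2 by nra.
have z0 : z != 0 by rewrite -cabs_eq0 z1 oner_eq0.
have zz : z * z^* = 1 by rewrite -normCK cabsE z1 expr1n.
rewrite (RweightE _ _ _ gu ga) ?t0//=; last lra.
set l := cln _; rewrite -/A -/B -/D; set W := (X in cexp X).
pose V := B * z^* - A * z.
have hl : cabs (l - t%:C%C * z) <= 10 * t ^+ 2.
  have := @cabs_clnB_le R (t%:C%C * z).
  by rewrite cabsM z1 mulr1 cabsR gtr0_norm// => /(_ (ltW t8)).
have hD : cabs (ln (1 - t ^+ 2))%:C%C <= 2 * t ^+ 2.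
  rewrite cabsR; have := @norm_lnB_le R (- t ^+ 2).
  rewrite normrN ger0_norm// => h; have {h}/h : t ^+ 2 <= 1 / 2 by lra.
  rewrite sqrrN; have : (t ^+ 2) ^+ 2 <= 1 / 64 * t ^+ 2 by rewrite expr2 ler_wpM2r.
  by rewrite !ler_norml => ? /andP[? ?]; apply/andP; split; lra.
have hWV : cabs (W - t%:C%C * V) <= M * t ^+ 2.
  have -> : W - t%:C%C * V = D * (ln (1 - t ^+ 2))%:C%C
     + (- A * (l - t%:C%C * z) + B * (l - t%:C%C * z)^* ).
    rewrite /W /V rmorphB rmorphM /= conj_real_complex; ring.
  apply: (le_trans (ler_cabsD _ _)); have := ler_cabsD (- A * (l - t%:C%C * z)) (B * (l - t%:C%C * z)^* ).
  rewrite !cabsM cabsJ cabsN /M.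
  have := ler_wpM2l A0 hl; have := ler_wpM2l B0 hl; have := ler_wpM2l D0 hD; lra.
have hV : cabs V <= cabs A + cabs B.
  apply: (le_trans (ler_cabsD _ _)); rewrite cabsN !cabsM cabsJ z1; lra.
have hW : cabs W <= L * t.
  rewrite -[W](subrK (t%:C%C * V)); apply: (le_trans (ler_cabsD _ _)).
  rewrite cabsM cabsR gtr0_norm// /L.
  have tt : t ^+ 2 <= t by rewrite expr2 ler_piMl//; lra.
  have := ler_wpM2l M0 tt; have := ler_wpM2l (ltW t0) hV; lra.
have W2 : cabs W <= 1 / 2 by lra.
have -> : z ^ n * cexp W - (z ^ n + t%:C%C * (B * z ^ (n - 1) - A * z ^ (n + 1)))
   = z ^ n * ((cexp W - 1 - W) + (W - t%:C%C * V)).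
  rewrite !expfzDr// expr1z exprN1 (_ : z^-1 = z^* ); first by rewrite /V; ring.
  by apply: (mulfI z0); rewrite zz divff.
have zn : cabs (z ^ n) = 1.
  case: (n) => k; first by rewrite cabsX z1 expr1n.
  by rewrite (_ : z ^ Negz k = (z ^+ k.+1)^-1)// cabsV cabsX z1 expr1n invr1.
rewrite cabsM zn mul1r; apply: (le_trans (ler_cabsD _ _)).
have h1 := cabs_cexpB1B_le W2.
have : cabs W ^+ 2 <= L ^+ 2 * t ^+ 2 by rewrite -exprMn ler_pXn2r// ?nnegrE ?cabs_ge0//; nra.
have := sqr_ge0 t; nra.
Qed.

End Multiplier.

(** * Fourier coefficients *)

Section FourierIntegrals.
Variable R : realType.
Notation C := R[i].
Implicit Types (k h : R -> C) (x y t : R).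
Notation leb := (@lebesgue_measure R).

Lemma measurable_period : measurable (@period R : set (measurableTypeR R)).
Proof. exact: measurable_itv. Qed.

#[local] Hint Resolve measurable_period : core.

Lemma period_measure : leb (@period R) = (2 * pi)%:E.
Proof.
rewrite lebesgue_measure_itv/= lte_fin gtrN ?pi_gt0// -EFinB; congr EFin; ring.
Qed.

Lemma Rintegral_period (f F : R -> R) :
  (forall x : R, is_derive x 1 F (f x)) -> continuous f ->
  \int[leb]_(x in @period R) f x = F pi - F (- pi).
Proof.
move=> dF cf.
have cF : continuous F.
  by move=> x; apply: differentiable_continuous; apply/derivable1_diffP; have [] := dF x.
have p0 : - pi < pi :> R by rewrite gtrN ?pi_gt0.
have ci a b : {within `[a, b], continuous f} by exact: continuous_subspaceT.
rewrite /period Rintegral_itv_obnd_cbnd; last first.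
  apply: (@integrableS _ _ _ leb `[- pi, pi]) => //.
    by apply: subset_itvr; rewrite bnd_simp.
  by apply: continuous_compact_integrable => [|]; [exact: segment_compact|exact: ci].
rewrite /Rintegral (@continuous_FTC2 _ f F)//.
  split; first by move=> x _; have [] := dF x.
    exact: cvg_at_right_filter (cF _).
  exact: cvg_at_left_filter (cF _).
by move=> x _; rewrite derive1E derive_val.
Qed.

Lemma Rintegral_period_cst (r : R) : \int[leb]_(x in @period R) r = r * (2 * pi).
Proof.
rewrite Rintegral_cst; last exact: measurable_period.
exact: (congr1 (fun y : \bar R => r * fine y) period_measure).
Qed.

(** Integrability is always deduced from measurability and boundedness, the period having finite
    measure. *)
Definition cmeas k := measurable_fun (@period R) (fun t => complex.Re (k t)) /\
  measurable_fun (@period R) (fun t => complex.Im (k t)).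

Definition cbounded (M : R) k := forall t, cabs (k t) <= M.

Definition cint k : C := (\int[leb]_(t in @period R) complex.Re (k t)
  +i* \int[leb]_(t in @period R) complex.Im (k t))%C.

Lemma bounded_integrable M (f : R -> R) : measurable_fun (@period R) f ->
  (forall t, `|f t| <= M) -> leb.-integrable (@period R) (EFin \o f).
Proof.
move=> mf bf; apply: (@measurable_bounded_integrable _ _ _ leb).
- exact: measurable_period.
- by rewrite [X in (X < _)%E](_ : _ = (2 * pi)%:E) ?ltry//; exact: period_measure.
- exact: mf.
- by exists M; split; rewrite ?num_real// => N MN t _; exact: le_trans (bf t) (ltW MN).
Qed.

Lemma Re_integrable M k : cmeas k -> cbounded M k ->
  leb.-integrable (@period R) (EFin \o (fun t => complex.Re (k t))).
Proof.
by move=> [m _] b; apply: (@bounded_integrable M) => // t; apply: le_trans (ler_Re_cabs _) _.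
Qed.

Lemma Im_integrable M k : cmeas k -> cbounded M k ->
  leb.-integrable (@period R) (EFin \o (fun t => complex.Im (k t))).
Proof.
by move=> [_ m] b; apply: (@bounded_integrable M) => // t; apply: le_trans (ler_Im_cabs _) _.
Qed.

Lemma cmeasD k h : cmeas k -> cmeas h -> cmeas (fun t => k t + h t).
Proof.
move=> [k1 k2] [h1 h2]; split.
- by under eq_fun do rewrite raddfD /=; exact: measurable_funD.
- by under eq_fun do rewrite raddfD /=; exact: measurable_funD.
Qed.

Lemma ReM (a b : C) : complex.Re (a * b) =
  complex.Re a * complex.Re b - complex.Im a * complex.Im b.
Proof. by case: a b => ? ? []. Qed.

Lemma ImM (a b : C) : complex.Im (a * b) =
  complex.Re a * complex.Im b + complex.Im a * complex.Re b.
Proof. by case: a b => ? ? []. Qed.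

Lemma cmeasM k h : cmeas k -> cmeas h -> cmeas (fun t => k t * h t).
Proof.
move=> [k1 k2] [h1 h2]; split.
- under eq_fun do rewrite ReM /=; apply: measurable_funB; exact: measurable_funM.
- under eq_fun do rewrite ImM /=; apply: measurable_funD; exact: measurable_funM.
Qed.

Lemma cmeas_cst (a : C) : cmeas (fun=> a).
Proof. by split; exact: measurable_cst. Qed.

Lemma cont_affine (a : R) (f : R -> R) : continuous f -> continuous (fun t => f (a * t)).
Proof.
move=> cf x; apply: (@continuous_comp _ _ _ ( *%R a) f); last exact: cf.
exact: mulrl_continuous.
Qed.

Lemma cmeas_expi (a : R) : cmeas (fun t => expi (a * t)).
Proof.
split; apply: measurable_funTS; apply: continuous_measurable_fun; apply: cont_affine => x /=.
- exact: continuous_cos.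
- exact: continuous_sin.
Qed.

Lemma cabs_expi x : cabs (expi x) = 1.
Proof.
by rewrite -[LHS]ger0_norm ?cabs_ge0// -sqrtr_sqr sqr_cabs /= cos2Dsin2 sqrtr1.
Qed.

Lemma expiD x y : expi (x + y) = expi x * expi y.
Proof. by apply: complex_eq; rewrite /= ?cosD ?sinD//; ring. Qed.

Lemma expi_cexp x : expi x = cexp (0 +i* x)%C.
Proof. by rewrite /cexp /= expR0 mul1r. Qed.

Lemma expi_int (n : int) x : expi x ^ n = expi (n%:~R * x).
Proof.
rewrite !expi_cexp -cexpM_int; congr cexp.
have -> : (n%:~R : C) = (n%:~R : R)%:C%C by rewrite rmorph_int.
by apply: complex_eq => /=; ring.
Qed.

Lemma cintD M N k h : cmeas k -> cbounded M k -> cmeas h -> cbounded N h ->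
  cint (fun t => k t + h t) = cint k + cint h.
Proof.
move=> mk bk mh bh; apply: complex_eq; rewrite /cint/=.
- under eq_Rintegral do rewrite raddfD /=; rewrite RintegralD//.
  + exact: Re_integrable mk bk.
  + exact: Re_integrable mh bh.
- under eq_Rintegral do rewrite raddfD /=; rewrite RintegralD//.
  + exact: Im_integrable mk bk.
  + exact: Im_integrable mh bh.
Qed.

Lemma cintZ M (a : C) k : cmeas k -> cbounded M k ->
  cint (fun t => a * k t) = a * cint k.
Proof.
move=> mk bk; have iR := Re_integrable mk bk; have iI := Im_integrable mk bk.
have iz (r : R) (f : R -> R) : leb.-integrable (@period R) (EFin \o f) ->
    leb.-integrable (@period R) (EFin \o (fun t => r * f t)).
  by move=> fi; exact: (integrableZl measurable_period r fi).
apply: complex_eq; rewrite ?ReM ?ImM /=.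
- under eq_Rintegral do rewrite ReM.
  by rewrite RintegralB ?RintegralZl//; exact: iz.
- under eq_Rintegral do rewrite ImM.
  by rewrite RintegralD ?RintegralZl//; exact: iz.
Qed.

Lemma cabs_cint_le M k : cmeas k -> cbounded M k -> cabs (cint k) <= 4 * pi * M.
Proof.
move=> mk bk; have iR := Re_integrable mk bk; have iI := Im_integrable mk bk.
have h (f : R -> R) : leb.-integrable (@period R) (EFin \o f) ->
   (forall t, `|f t| <= M) -> `|\int[leb]_(t in @period R) f t| <= M * (2 * pi).
  move=> fi fM; apply: (le_trans (le_normr_Rintegral measurable_period fi)).
  rewrite -Rintegral_period_cst.
  apply: le_Rintegral => //.
  - exact: integrable_norm fi.
  - apply: (@bounded_integrable `|M|) => //.
apply: (le_trans (ler_cabs _)) => /=.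
rewrite (_ : _ * M = M * (2 * pi) + M * (2 * pi)); last by ring.
apply: lerD; apply: h => // t; apply: le_trans (bk t).
- exact: ler_Re_cabs.
- exact: ler_Im_cabs.
Qed.

Lemma cint_expi (n : int) : cint (fun t => expi (n%:~R * t)) = (2 * pi * (n == 0)%:R)%:C%C.
Proof.
have [->|n0] := eqVneq n 0.
  rewrite /cint /=; under eq_Rintegral do rewrite mul0r cos0.
  under [X in (_ +i* X)%C]eq_Rintegral do rewrite mul0r sin0.
  by rewrite !Rintegral_period_cst; apply: complex_eq => /=; ring.
have a0 : n%:~R != 0 :> R by rewrite intr_eq0.
rewrite mulr0; apply: complex_eq => /=.
- have d (x : R) : is_derive x 1 (fun t : R => n%:~R^-1 * sin (n%:~R * t)) (cos (n%:~R * x)).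
    by apply: is_derive_eq; rewrite /GRing.scale/= ?(mulr0, mulr1, addr0, add0r); field.
  rewrite (Rintegral_period d); last first.
    by apply: cont_affine => x; exact: continuous_cos.
  rewrite mulrN sinN.
  (* This is the imaginary part of [expi pi ^ n], an integer power of the real number -1. *)
  suff -> : sin (n%:~R * pi) = 0 :> R by ring.
  have := expi_int n pi => /(congr1 (@complex.Im R)) /= <-.
  rewrite (_ : expi pi = (-1)%:C%C); last by apply: complex_eq; rewrite /= ?cospi ?sinpi.
  case: (n) => k; first by rewrite -exprnP -rmorphXn.
  by rewrite (_ : _ ^ Negz k = ((-1)%:C%C ^+ k.+1)^-1)// -rmorphXn -fmorphV.
- have d (x : R) : is_derive x 1 (fun t : R => - n%:~R^-1 * cos (n%:~R * t)) (sin (n%:~R * x)).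
    by apply: is_derive_eq; rewrite /GRing.scale/= ?(mulr0, mulr1, addr0, add0r); field.
  rewrite (Rintegral_period d); last first.
    by apply: cont_affine => x; exact: continuous_sin.
  by rewrite mulrN cosN subrr.
Qed.

End FourierIntegrals.

(** * Hilbert spaces *)

Section HilbertSpaces.
Variable R : realType.
Notation C := R[i].
Lemma lipschitz_continuous (V W : normedModType R[i]) (L : V -> W) (M : C) :
  linear L -> (forall x : V, `|L x| <= M * `|x|) -> continuous L.
Proof.
move=> linL bL x; apply/cvgrPdist_lt => eps eps0.
have LB y : L x - L y = L (x - y).
  by have := linL (-1) y x; rewrite !scaleN1r addrC => <-; rewrite addrC.
have M0 : 0 < `|M| + 1 by rewrite ltr_wpDl.
have idx : y @[y --> x] --> x by exact: cvg_id.
have e0 : 0 < eps / (`|M| + 1) by rewrite divr_gt0.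
have hx := (cvgrPdist_lt _ _).1 idx _ e0.
near=> y.
have : `|x - y| < eps / (`|M| + 1) by near: y; exact: hx.
rewrite ltr_pdivlMr// => h.
rewrite LB; apply: (le_lt_trans (bL _)); apply: le_lt_trans h; rewrite mulrC.
(* Only at a nonzero vector does the bound on [L] imply [0 <= M]. *)
have [->|xy] := eqVneq (x - y) 0; first by rewrite normr0 !mul0r.
have xy0 : 0 < `|x - y| by rewrite normr_gt0.
rewrite ler_pM2l//.
have Mr : 0 <= M by rewrite -(pmulr_lge0 _ xy0); apply: le_trans (bL _).
by rewrite ger0_norm// lerDl.
Unshelve. all: by end_near. Qed.

Section H.
Variable H : hilbertType R.
Implicit Types (x y v : H) (a c : C).

Lemma hdotDl x x' y : hdot (x + x') y = hdot x y + hdot x' y.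
Proof. by have := hdot_linearl y 1 x x'; rewrite scale1r mul1r. Qed.

Lemma hdot0l y : hdot (0 : H) y = 0.
Proof. by apply: (@addrI _ (hdot 0 y)); rewrite -hdotDl !addr0. Qed.

Lemma hdotZl a x y : hdot (a *: x) y = a * hdot x y.
Proof. by have := hdot_linearl y a x 0; rewrite !addr0 hdot0l addr0. Qed.

Lemma hdotBl x x' y : hdot (x - x') y = hdot x y - hdot x' y.
Proof. by rewrite -scaleN1r hdotDl hdotZl mulN1r. Qed.

Lemma hdotZr a y x : hdot y (a *: x) = a^* * hdot y x.
Proof. by rewrite hdot_conj hdotZl rmorphM /= -!hdot_conj. Qed.

Lemma hdotBr y x x' : hdot y (x - x') = hdot y x - hdot y x'.
Proof. by rewrite hdot_conj hdotBl rmorphB /= -!hdot_conj. Qed.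

Lemma hdot0r y : hdot y (0 : H) = 0.
Proof. by rewrite hdot_conj hdot0l rmorph0. Qed.

Lemma hdot_eq0 x : (hdot x x == 0) = (x == 0).
Proof. by rewrite hdot_norm sqrf_eq0 normr_eq0. Qed.

(** Pythagoras for the projection onto the line of [v]; it yields both Cauchy-Schwarz and the
    near-orthogonality of minimizing sequences. *)
Lemma norm_sub_proj x v : v != 0 ->
  `|x - (hdot x v / hdot v v) *: v| ^+ 2 = `|x| ^+ 2 - `|hdot x v| ^+ 2 / `|v| ^+ 2.
Proof.
move=> v0; have vv : hdot v v != 0 by rewrite hdot_eq0.
have vr : (hdot v v)^* = hdot v v by rewrite -hdot_conj.
rewrite -!hdot_norm normCK !(hdotBl, hdotBr, hdotZl, hdotZr) rmorphM fmorphV /= vr.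
by rewrite (hdot_conj x v); field.
Qed.

Lemma cauchy_schwarz x v : `|hdot x v| <= `|x| * `|v|.
Proof.
have [->|v0] := eqVneq v 0; first by rewrite hdot0r !normr0 mulr0.
rewrite -(@ler_pXn2r _ 2)// ?nnegrE ?mulr_ge0// exprMn.
have vp : 0 < `|v| ^+ 2 by rewrite exprn_gt0// normr_gt0.
by rewrite -ler_pdivrMr// -subr_ge0 -norm_sub_proj// exprn_ge0.
Qed.

Lemma norm2_real v : `|v| ^+ 2 = (complex.Re (`|v| ^+ 2))%:C%C.
Proof. by rewrite RRe_real// ger0_real// exprn_ge0. Qed.

(* Otherwise the orthogonal projection of x onto the kernel would leave a nonzero
   vector orthogonal to all the e i.  A minimizing sequence u with squared
   distances below d + 1 / (n + 1)^2 is nearly orthogonal to the kernel, and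
   this also makes it Cauchy. *)
Lemma dense_kernel (K : normedModType R[i]) (I : Type) (e : I -> H) (L : H -> K) :
  (forall x, (forall i, hdot x (e i) = 0) -> x = 0) -> linear L -> continuous L ->
  (forall i, L (e i) = 0) -> forall x, L x = 0.
Proof.
move=> tot linL cL Le x.
have LD y z : L (y + z) = L y + L z by have := linL 1 y z; rewrite !scale1r.
have L0 : L 0 = 0 by apply: (@addrI _ (L 0)); rewrite -LD !addr0.
have LZ a y : L (a *: y) = a *: L y by have := linL a y 0; rewrite !addr0 L0 addr0.
pose q v : R := complex.Re (`|v| ^+ 2).
have qE v : `|v| ^+ 2 = (q v)%:C%C by exact: norm2_real.
pose S := [set q (x - m) | m in [set m | L m = 0]].
pose d := inf S.
have S0 : has_inf S.
  split; first by exists (q (x - 0)), 0.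
  exists 0 => _ [m _ <-]; rewrite -lecR -qE; exact: exprn_ge0.
have dS m : L m = 0 -> d <= q (x - m) by move=> Lm; apply: ge_inf; [case: S0|exists m].
have ep n : 0 < n.+1%:R^-1 :> R by rewrite invr_gt0.
have /choice[u uP] n : exists m, L m = 0 /\ q (x - m) < d + n.+1%:R^-1 ^+ 2.
  have e0 : 0 < n.+1%:R^-1 ^+ 2 :> R by rewrite exprn_gt0.
  by have [_ [m Lm <-] h] := inf_adherent e0 S0; exists m.
have near_orth n v : L v = 0 -> `|hdot (x - u n) v| <= `|v| * (n.+1%:R^-1)%:C%C.
  move=> Lv; have [->|v0] := eqVneq v 0; first by rewrite hdot0r !normr0 mul0r.
  have vp : 0 < `|v| ^+ 2 by rewrite exprn_gt0// normr_gt0.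
  have [Lu qu] := uP n.
  have en0 : 0 <= (n.+1%:R^-1)%:C%C :> C by rewrite ler0c ltW.
  rewrite -(@ler_pXn2r _ 2)// ?nnegrE ?mulr_ge0//.
  rewrite exprMn mulrC -ler_pdivrMr//.
  rewrite [leRHS](_ : _ = (n.+1%:R^-1 ^+ 2)%:C%C); last by rewrite rmorphXn.
  (* [u n + c *: v] stays in the kernel, so it cannot beat the infimum [d]: the gain
     [|<x - u n, v>|^2 / |v|^2] is at most the excess of [u n] over [d]. *)
  set c := hdot (x - u n) v / hdot v v.
  have := @dS (u n + c *: v); rewrite LD LZ Lu Lv scaler0 addr0 => /(_ erefl).
  rewrite opprD addrA -lecR -qE norm_sub_proj// qE => h.
  apply: (@le_trans _ _ (q (x - u n) - d)%:C%C).
    by rewrite rmorphB /= lerBrDr -lerBrDl.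
  by rewrite lecR lerBlDl ltW.
have cu n k : `|u n - u k| <= (n.+1%:R^-1 + k.+1%:R^-1)%:C%C.
  have [->|v0] := eqVneq (u n - u k) 0.
    by rewrite normr0 -[0]/(0%:C%C) lecR addr_ge0// ltW.
  have Lv : L (u n - u k) = 0.
    by rewrite -scaleN1r LD LZ !(proj1 (uP _)) scaler0 addr0.
  have vp : 0 < `|u n - u k| by rewrite normr_gt0.
  rewrite -(ler_pM2l vp) -expr2 -hdot_norm.
  rewrite -[hdot _ _]ger0_norm ?hdot_norm ?exprn_ge0// -hdot_norm.
  (* The difference lies in the kernel, so both vectors on the right are nearly orthogonal to it. *)
  have -> : hdot (u n - u k) (u n - u k) =
      hdot (x - u k) (u n - u k) - hdot (x - u n) (u n - u k).
    by rewrite -hdotBl; congr hdot; rewrite opprB [RHS]addrC addrA subrK.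
  apply: (le_trans (ler_normB _ _)); rewrite rmorphD mulrDr addrC lerD//; exact: near_orth.
have posR (r : C) : 0 < r -> exists2 s : R, 0 < s & r = s%:C%C.
  move=> r0; have /complex_realP[s es] : r \is Num.real by rewrite gtr0_real.
  by exists s => //; move: r0; rewrite es ltcR.
have /cvg_ex[m um] : cvg (u @ \oo).
  apply: cauchy_cvg; apply/cauchyP => _ /posR[r r0 ->].
  have r20 : 0 < r / 2 by rewrite divr_gt0.
  have [N _ hN] := near_infty_natSinv_lt (PosNum r20).
  exists (u N), N => // k /= Nk; rewrite -ball_normE /=.
  apply: (le_lt_trans (cu _ _)); rewrite ltcR.
  have h1 : N.+1%:R^-1 < r / 2 := hN N (leqnn N).
  have h2 : k.+1%:R^-1 < r / 2 := hN k Nk.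
  by rewrite (splitr r) ltrD.
have Lm : L m = 0.
  have h : (L \o u) @ \oo --> L m by apply: (cvg_comp _ _ um); exact: cL.
  have h' : (L \o u) @ \oo --> (0 : K).
    rewrite (_ : L \o u = fun=> 0); first exact: cvg_cst.
    by apply/funext => n; exact: (proj1 (uP n)).
  exact: (norm_cvg_unique h h').
suff : x - m = 0 by move/eqP; rewrite subr_eq0 => /eqP ->.
apply: tot => i; set w := e i.
have bd (r : R) : 0 < r -> `|hdot (x - m) w| <= (2 * r)%:C%C * `|w|.
  move=> r0; have rc : 0 < r%:C%C :> C by rewrite ltcR.
  have [N _ hN] := near_infty_natSinv_lt (PosNum r0).
  have := (cvgrPdist_lt _ _).1 um _ rc => -[M _ hM].
  pose n := maxn N M.
  have -> : x - m = (x - u n) - (m - u n) by rewrite opprB addrA subrK.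
  rewrite hdotBl; apply: (le_trans (ler_normB _ _)).
  rewrite (_ : 2 * r = r + r) ?rmorphD ?mulrDl; last by ring.
  apply: lerD.
    apply: (le_trans (near_orth n w (Le i))); rewrite mulrC ler_wpM2r// lecR ltW//.
    by apply: hN; exact: leq_maxl.
  apply: (le_trans (cauchy_schwarz _ _)); rewrite ler_wpM2r// ltW//.
  by apply: hM; exact: leq_maxr.
apply/eqP; rewrite -normr_eq0; apply: contraT => h0.
have /posR[a a0 ea] : 0 < `|hdot (x - m) w| by rewrite lt_def h0 normr_ge0.
have /complex_realP[b eb] : `|w| \is Num.real by exact: normr_real.
have b0 : 0 <= b by rewrite -ler0c -eb.
(* With this radius the bound [2 * r * b] is less than [a], a contradiction. *)
have r0 : 0 < a / (4 * (b + 1)) by rewrite divr_gt0//; lra.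
have := bd _ r0; rewrite ea eb -rmorphM lecR.
rewrite (_ : 2 * _ * b = a * (b / (2 * (b + 1)))); last by field; rewrite gt_eqF//; lra.
rewrite ler_pMr// ler_pdivlMr ?mul1r; lra.
Qed.

Lemma hdot_linear (w : H) : linear (fun x => hdot x w : R[i]^o).
Proof. by move=> a x y; rewrite hdot_linearl. Qed.

Lemma hdot_continuous (w : H) : continuous (fun x => hdot x w : R[i]^o).
Proof.
by apply: (@lipschitz_continuous _ _ _ `|w|) (hdot_linear w) _ => x; rewrite mulrC cauchy_schwarz.
Qed.

End H.
End HilbertSpaces.

(** * The continuous series *)

Section ContinuousSeries.
Variable R : realType.
Notation C := R[i].

(** Serves to compare leading coefficients, once a remainder estimate has been divided by a power of
    [r]. *)
Lemma le_small_eq0 (A K d : R) : 0 <= A -> 0 < d ->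
  (forall r, 0 < r < d -> A <= K * r) -> A = 0.
Proof.
move=> A0 d0 h; apply/eqP; rewrite eq_le A0 andbT leNgt; apply/negP => Ap.
have K0 : 0 < K.
  have r0 : 0 < d / 2 < d by apply/andP; split; lra.
  have := h _ r0; nra.
have r0 : 0 < Num.min (d / 2) (A / (2 * K)).
  by rewrite lt_min !divr_gt0// mulr_gt0.
have rd : 0 < Num.min (d / 2) (A / (2 * K)) < d.
  by rewrite r0 gt_min; apply/orP; left; lra.
have := h _ rd.
have : Num.min (d / 2) (A / (2 * K)) <= A / (2 * K) by rewrite ge_min lexx orbT.
rewrite -(ler_pM2l K0) (_ : K * (A / _) = A / 2); last by field; rewrite gt_eqF.
lra.
Qed.

Section Coord.
Variables (I : eqType) (H : hilbertType R) (e : I -> H).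
Hypothesis be : orthogonal_basis e.

Lemma coord_hdot x i : hdot x (e i) = coord e x i * hdot (e i) (e i).
Proof. by case: be => e0 _ _; rewrite mulfVK// hdot_eq0; exact/eqP. Qed.

Lemma coord_lin (a : C) (x y : H) i : coord e (a *: x + y) i = a * coord e x i + coord e y i.
Proof. by rewrite /coord hdot_linearl mulrDl mulrA. Qed.

Lemma coordZ (a : C) (x : H) i : coord e (a *: x) i = a * coord e x i.
Proof. by rewrite /coord hdotZl mulrA. Qed.

Lemma coord_basis j i : coord e (e j) i = (j == i)%:R.
Proof.
case: be => e0 eo _; have [->|ji] := eqVneq j i.
  by rewrite /coord divff// hdot_eq0; exact/eqP.
by rewrite /coord eo ?mul0r//; exact/eqP.
Qed.

Lemma coord_inj x y : (forall i, coord e x i = coord e y i) -> x = y.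
Proof.
move=> h; apply/eqP; rewrite -subr_eq0; apply/eqP; case: be => _ _; apply => i.
by rewrite hdotBl (coord_hdot x) (coord_hdot y) h subrr.
Qed.

End Coord.

Lemma fourier_coef_cint (f : C -> C) (n : int) :
  fourier_coef f n = ((2 * pi)^-1)%:C%C * cint (fun t => f (expi t) * expi ((- n)%:~R * t)).
Proof. by rewrite rmorphN. Qed.

Lemma expi_intM (n i : int) (t : R) : expi t ^ n * expi ((- i)%:~R * t) = expi ((n - i)%:~R * t).
Proof. by rewrite expi_int -expiD -mulrDl -rmorphD. Qed.

Lemma fourier_monomial (c : C) (n i : int) : fourier_coef (fun z => c * z ^ n) i = c * (n == i)%:R.
Proof.
rewrite fourier_coef_cint; under eq_fun do rewrite -mulrA expi_intM.
rewrite (@cintZ _ 1) ?cint_expi.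
- rewrite mulrCA -rmorphM mulrA mulVf ?mul1r ?subr_eq0 ?rmorph_nat//.
  by rewrite mulf_neq0// gt_eqF// pi_gt0.
- exact: cmeas_expi.
- by move=> t; rewrite cabs_expi.
Qed.

(** Only trigonometric polynomials and bounded remainders have to be added, so boundedness can
    replace square integrability. *)
Definition circ_bdd (f : C -> C) := cmeas (fun t => f (expi t)) /\
  exists M, cbounded M (fun t => f (expi t)).

Lemma circ_bdd_mono (c : C) (n : int) : circ_bdd (fun z => c * z ^ n).
Proof.
split; last by exists (cabs c) => t; rewrite expi_int cabsM cabs_expi mulr1.
apply: cmeasM; first exact: cmeas_cst.
by under eq_fun do rewrite expi_int; exact: cmeas_expi.
Qed.

Lemma circ_bddD (f h : C -> C) : circ_bdd f -> circ_bdd h -> circ_bdd (fun z => f z + h z).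
Proof.
move=> [mf [M bf]] [mh [N bh]]; split; first exact: cmeasD.
by exists (M + N) => t; apply: (le_trans (ler_cabsD _ _)); exact: lerD.
Qed.

Lemma fourier_coefD (f h : C -> C) i : circ_bdd f -> circ_bdd h ->
  fourier_coef (fun z => f z + h z) i = fourier_coef f i + fourier_coef h i.
Proof.
move=> [mf [M bf]] [mh [N bh]]; rewrite !fourier_coef_cint -mulrDr; congr (_ * _).
under eq_fun do rewrite mulrDl; apply: (@cintD _ M N).
- by apply: cmeasM => //; exact: cmeas_expi.
- by move=> t; rewrite cabsM cabs_expi mulr1.
- by apply: cmeasM => //; exact: cmeas_expi.
- by move=> t; rewrite cabsM cabs_expi mulr1.
Qed.

Lemma fourier_coef_le (f : C -> C) i M : cmeas (fun t => f (expi t)) ->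
  cbounded M (fun t => f (expi t)) -> cabs (fourier_coef f i) <= 2 * M.
Proof.
move=> mf bf; have p0 := pi_gt0 R; rewrite fourier_coef_cint cabsM cabsR gtr0_norm; last first.
  by rewrite invr_gt0 mulr_gt0.
rewrite mulrC ler_pdivrMr ?mulr_gt0// (_ : 2 * M * _ = 4 * pi * M); last by ring.
apply: cabs_cint_le; first by apply: cmeasM => //; exact: cmeas_expi.
by move=> t; rewrite cabsM cabs_expi mulr1.
Qed.

Lemma L2_circle_monomial (n : int) : L2_circle (fun z : C => z ^ n).
Proof.
have [m1 m2] := @cmeas_expi R n%:~R.
split.
- by under eq_fun do rewrite expi_int.
- by under eq_fun do rewrite expi_int.
- under eq_integral do rewrite expi_int cabs_expi expr1n.
  rewrite integral_cst//= ?mul1e; last exact: measurable_period.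
  by rewrite [X in (X < _)%E](_ : _ = (2 * pi)%:E) ?ltry//; exact: period_measure.
Qed.

Lemma circle_vec_basis (H : hilbertType R) (e : int -> H) n :
  orthogonal_basis e -> circle_vec e (e n) (fun z => z ^ n).
Proof.
move=> be; split; first exact: L2_circle_monomial.
move=> i; rewrite coord_basis//; have := fourier_monomial 1 n i.
by under eq_fun do rewrite mul1r; rewrite mul1r.
Qed.

Section Rotation.
Variable g : mob R.
Hypothesis ga : mob_a g = 0.

Lemma cln1 : cln (1 : C) = 0.
Proof. by rewrite /cln cabs1 ln1 carg1. Qed.

Lemma rot_den (z : C) : 1 - (mob_a g)^* * z = 1.
Proof. by rewrite ga rmorph0 mul0r subr0. Qed.

Lemma rot_fun z : mob_fun g z = mob_u g * z.
Proof. by rewrite /mob_fun rot_den ga subr0 divr1. Qed.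

Lemma rot_pow (s z : C) : mob_der_pow g s z = cexp (s * (0 +i* carg (mob_u g))%C).
Proof.
by rewrite /mob_der_pow /mob_der_log rot_den cln1 mulr0 subr0 ga cabs0 expr0n subr0 ln1.
Qed.

Lemma rot_weight (lambda : R) (mu z : C) :
  Rweight lambda mu g z = cexp ((lambda / 2)%:C%C * (0 +i* carg (mob_u g))%C).
Proof.
rewrite /Rweight rot_pow /mob_der rot_den ga normr0 expr0n subr0 expr1n divr1 mulr1.
have -> : cabs (mob_u g) = 1 by apply: complexI; rewrite -cabsE mob_uP.
by rewrite ln1 mulr0 cexp0 mulr1.
Qed.

(** A rotation has constant derivative, so its multiplier is a scalar and every monomial is an
    eigenvector. *)
Lemma circle_rotation (lambda : R) (mu : C) (H : hilbertType R) (e : int -> H) pi n :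
  orthogonal_basis e -> circle_rep lambda mu e pi ->
  pi g^-1%g (e n) = (cexp ((lambda / 2)%:C%C * (0 +i* carg (mob_u g))%C) * mob_u g ^ n) *: e n.
Proof.
move=> be rep; apply: (coord_inj be) => i.
have [_ ->] := rep g _ _ (circle_vec_basis n be).
rewrite coordZ.
rewrite coord_basis//.
rewrite -(fourier_monomial (cexp ((lambda / 2)%:C%C * (0 +i* carg (mob_u g))%C) * mob_u g ^ n) n i).
apply: (congr1 (fun f => fourier_coef f i)).
by apply/funext => z; rewrite rot_weight rot_fun expfzMl mulrA.
Qed.

End Rotation.

(** The uniform expansion on the circle passes to Fourier coefficients, at the cost of the factor 2
    of [fourier_coef_le]. *)
Lemma circle_expansion (lambda : R) (mu : C) (n : int) : exists2 K : R, 1 < K &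
  forall (H : hilbertType R) (e : int -> H) pi (g : mob R) t i,
  orthogonal_basis e -> circle_rep lambda mu e pi ->
  mob_u g = 1 -> mob_a g = (- t)%:C%C -> 0 < t -> t * K < 1 ->
  cabs (coord e (pi g^-1%g (e n)) i - ((n == i)%:R + t%:C%C * ((n%:~R - mu) * (n - 1 == i)%:R
     - (lambda%:C%C + mu + n%:~R) * (n + 1 == i)%:R))) <= 2 * K * t ^+ 2.
Proof.
have [K K1 hK] := Rweight_expansion lambda mu n; exists K => //.
move=> H e pi' g t i be rep gu ga t0 tK.
(* Measurability of the transformed function comes with [rep], through [L2_circle]. *)
have [[m1 m2 _] ->] := rep g _ _ (circle_vec_basis n be).
set F := (fun z => Rweight lambda mu g z * mob_fun g z ^ n) in m1 m2 *.
set A := n%:~R - mu; set B := lambda%:C%C + mu + n%:~R.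
pose P (z : C) := 1 * z ^ n + (t%:C%C * A * z ^ (n - 1) + (- (t%:C%C * B)) * z ^ (n + 1)).
have bP : circ_bdd P by do 2![apply: circ_bddD; first exact: circ_bdd_mono]; exact: circ_bdd_mono.
have bNP : circ_bdd (fun z => -1 * P z).
  case: bP => mP [M bP]; split; first by apply: cmeasM => //; exact: cmeas_cst.
  by exists M => s; rewrite cabsM cabsN cabs1 mul1r.
pose G (z : C) := F z + -1 * P z.
have mG : cmeas (fun s => G (expi s)) by apply: cmeasD => //; case: bNP.
have bG : cbounded (K * t ^+ 2) (fun s => G (expi s)).
  move=> s; have := hK g t (expi s) gu ga t0 tK (cabs_expi s).
  rewrite -/A -/B; congr (cabs _ <= _); rewrite /G /F /P; ring.
have pP : fourier_coef P i = (n == i)%:R + t%:C%C * (A * (n - 1 == i)%:R - B * (n + 1 == i)%:R).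
  rewrite /P fourier_coefD; try exact: circ_bdd_mono; last first.
    by apply: circ_bddD; exact: circ_bdd_mono.
  rewrite fourier_coefD; try exact: circ_bdd_mono.
  rewrite !fourier_monomial; ring.
have -> : F = (fun z => G z + P z) by apply/funext => z; rewrite /G; ring.
rewrite fourier_coefD//; last by split=> //; exists (K * t ^+ 2).
rewrite pP addrK -mulrA; exact: fourier_coef_le.
Qed.
End ContinuousSeries.

(** * The discrete series *)

Section DiscreteSeries.
Variable R : realType.
Notation C := R[i].

Lemma cabs_sum (n : nat) (u : nat -> C) m : cabs (\sum_(m <= k < n) u k) <= \sum_(m <= k < n) cabs (u k).
Proof.
apply: (big_ind2 (fun x y => cabs x <= y)) => //; first by rewrite cabs0.
by move=> x x' y y' h h'; apply: (le_trans (ler_cabsD _ _)); exact: lerD.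
Qed.

Lemma geometric_tail (x : R) n N : 0 <= x <= 1 / 2 -> (n <= N)%N ->
  \sum_(n <= k < N) x ^+ k <= 2 * x ^+ n.
Proof.
move=> /andP[x0 x1] nN.
(* Strengthened for the induction: the added term absorbs the next summand because [2 * x <= 1]. *)
suff : \sum_(n <= k < N) x ^+ k + 2 * x ^+ N <= 2 * x ^+ n.
  have : 0 <= x ^+ N by rewrite exprn_ge0.
  lra.
elim: N nN => [|N IH]; first by rewrite leqn0 => /eqP ->; rewrite big_geq// add0r.
rewrite leq_eqVlt => /predU1P[->|]; first by rewrite big_geq// add0r.
rewrite ltnS => nN; rewrite big_nat_recr//= exprS; have := IH nN.
have : 0 <= x ^+ N by rewrite exprn_ge0.
nra.
Qed.

(** Convergence at 1/2 gives [cabs (c n) <= M * 2 ^+ n]. By strong induction the lower terms vanish,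
    and at small real [r] the tail shows that [c n * r ^+ n] is O(r^(n+1)). *)
Lemma pseries_eq0 (c : nat -> C) :
  (forall z : C, `|z| < 1 ->
    (series (fun n => c n * z ^+ n) : nat -> R[i]^o) @ \oo --> (0 : R[i]^o)) ->
  forall n, c n = 0.
Proof.
move=> h.
have dsc (r : R) : 0 < r -> r < 1 -> `|r%:C%C : C| < 1.
  by move=> r0 r1; rewrite cabsE cabsR -[ltRHS]/(1%:C%C) ltcR gtr0_norm.
have [half0 half1] : 0 < 1 / 2 :> R /\ 1 / 2 < 1 :> R by split; lra.
have [M M0 hM] : exists2 M : R, 0 < M & forall n, cabs (c n) <= M * 2 ^+ n.
  have [M [/complex_realP[m ->] hM]] := cvg_seq_bounded (cvgP _ (cvg_series_cvg_0 (cvgP _ (h _ (dsc _ half0 half1))))).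
  exists (`|m| + 1) => [|n]; first by rewrite ltr_wpDl.
  have mM : m%:C%C < (`|m| + 1)%:C%C :> C by rewrite ltcR; have := ler_norm m; lra.
  have /= := hM _ mM n I; rewrite cabsE lecR cabsM cabsX cabsR ger0_norm//.
  by rewrite expr_div_n expr1n mul1r ler_pdivrMr// exprn_gt0.
elim/ltn_ind => n IH.
suff : cabs (c n) = 0 by move/eqP; rewrite cabs_eq0 => /eqP.
apply: (@le_small_eq0 R _ (2 * M * 2 ^+ n.+1 + M) (1 / 4)); [exact: cabs_ge0|lra|].
move=> r /andP[r0 r1].
have r2 : r < 1 by lra.
have x2 : 0 <= 2 * r <= 1 / 2 by apply/andP; split; lra.
have hr := dsc _ r0 r2.
(* The partial sum is taken this close to its limit 0, so that the error has the order of the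
   tail. *)
have e0 : 0 < (M * r ^+ n.+1)%:C%C :> C by rewrite ltcR mulr_gt0// exprn_gt0.
have := (cvgrPdist_lt _ _).1 (h _ hr) _ e0 => -[N _ hN].
have := hN (maxn N n.+1) (leq_maxl _ _).
set L := maxn _ _; have nL : (n.+1 <= L)%N by exact: leq_maxr.
rewrite sub0r normrN cabsE ltcR /series/=.
rewrite (@big_cat_nat _ _ _ n.+1)//= big_nat_recr//= big1_seq ?add0r; last first.
  by move=> k /andP[_]; rewrite mem_index_iota => /andP[_ /IH ->]; rewrite mul0r.
set T := \sum_(_ <= _ < L) _ => hT.
have hT2 : cabs T <= 2 * M * (2 * r) ^+ n.+1.
  apply: (le_trans (cabs_sum _ _ _)).
  apply: (@le_trans _ _ (\sum_(n.+1 <= k < L) M * (2 * r) ^+ k)).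
    apply: ler_sum => k _; rewrite cabsM cabsX cabsR gtr0_norm// exprMn mulrA.
    by rewrite ler_wpM2r// exprn_ge0// ltW.
  rewrite -mulr_sumr [leRHS](_ : _ = M * (2 * (2 * r) ^+ n.+1)); last by ring.
  rewrite ler_pM2l//.
  exact: geometric_tail.
have : cabs (c n * r%:C%C ^+ n) <= 2 * M * (2 * r) ^+ n.+1 + M * r ^+ n.+1.
  rewrite -[_ * _ ^+ n](addrK T); apply: (le_trans (ler_cabsD _ _)).
  by rewrite cabsN addrC lerD// ltW.
rewrite cabsM cabsX cabsR gtr0_norm// => hc; rewrite -(@ler_pM2r _ (r ^+ n)) ?exprn_gt0//.
apply: (le_trans hc); rewrite le_eqVlt; apply/orP; left; apply/eqP.
rewrite exprMn [r ^+ n.+1]exprS; ring.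
Qed.

Lemma disc_vec_inj (H : hilbertType R) (e : nat -> H) x y f :
  orthogonal_basis e -> disc_vec e x f -> disc_vec e y f -> x = y.
Proof.
move=> be hx hy; apply: (coord_inj be) => n; apply/eqP; rewrite -subr_eq0; apply/eqP.
move: n; apply: (@pseries_eq0 (fun n => coord e x n - coord e y n)) => z z1.
rewrite (_ : series _ = (series (fun n => coord e x n * z ^+ n) : nat -> R[i]^o)
   - (series (fun n => coord e y n * z ^+ n) : nat -> R[i]^o)); last first.
  apply/funext => n; rewrite fctE /series/= -sumrB; apply: eq_bigr => k _; exact: mulrBl.
rewrite -[0](subrr (f z)); apply: cvgB; [exact: hx|exact: hy].
Qed.

Lemma disc_vec_mono (H : hilbertType R) (e : nat -> H) (c : C) j :
  orthogonal_basis e -> disc_vec e (c *: e j) (fun z => c * z ^+ j).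
Proof.
move=> be z _; apply: cvg_near_cst; exists j.+1 => // n /= jn.
rewrite /series/= (bigD1_seq j) ?iota_uniq ?mem_index_iota//= coordZ coord_basis// eqxx mulr1.
rewrite big1 ?addr0// => k kj; rewrite coordZ coord_basis// eq_sym (negbTE kj).
by rewrite mulr0 mul0r.
Qed.

Lemma discrete_plus_rotation (g : mob R) (nu : R) (H : hilbertType R) (e : nat -> H) pi j :
  mob_a g = 0 -> discrete_plus nu e pi ->
  pi g^-1%g (e j) = (cexp ((nu / 2)%:C%C * (0 +i* carg (mob_u g))%C) * mob_u g ^+ j) *: e j.
Proof.
move=> ga [_ [be _] rep].
have h : disc_vec e (e j) (fun z => z ^+ j).
  have := disc_vec_mono (c := 1) (j := j) be; rewrite scale1r.
  by under eq_fun do rewrite mul1r.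
apply: (disc_vec_inj be (rep g _ _ h)).
rewrite (_ : (fun z => _) = (fun z => cexp ((nu / 2)%:C%C * (0 +i* carg (mob_u g))%C) * mob_u g ^+ j * z ^+ j)).
  exact: disc_vec_mono.
by apply/funext => z; rewrite rot_weight// rot_fun// exprMn mulrA.
Qed.

Lemma discrete_minus_rotation (g : mob R) (nu : R) (H : hilbertType R) (e : nat -> H) pi j :
  mob_a g = 0 -> discrete_minus nu e pi ->
  pi g^-1%g (e j) = (cexp ((nu / 2)%:C%C * (0 +i* carg (mob_u g))%C) * mob_u g ^+ j)^* *: e j.
Proof.
move=> ga [_ [be _] rep].
have h : disc_vec e (e j) (fun z => z ^+ j).
  have := disc_vec_mono (c := 1) (j := j) be; rewrite scale1r.
  by under eq_fun do rewrite mul1r.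
apply: (disc_vec_inj be (rep g _ _ h)).
rewrite (_ : (fun z => _) = (fun z => (cexp ((nu / 2)%:C%C * (0 +i* carg (mob_u g))%C) * mob_u g ^+ j)^* * z ^+ j)).
  exact: disc_vec_mono.
apply/funext => z; rewrite rot_pow// rot_fun// !rmorphM /= conjCK exprMn mulrA rmorphXn //.
Qed.
End DiscreteSeries.

(** * The intertwining relation *)

Section Intertwining.
Variable R : realType.
Notation C := R[i].

Lemma linear_opD (H K : hilbertType R) (L : H -> K) : linear L -> forall x y, L (x + y) = L x + L y.
Proof. by move=> l x y; have := l 1 x y; rewrite !scale1r. Qed.

Lemma linear_op0 (H K : hilbertType R) (L : H -> K) : linear L -> L 0 = 0.
Proof. by move=> l; apply: (@addrI _ (L 0)); rewrite -(linear_opD l) !addr0. Qed.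

Lemma linear_opZ (H K : hilbertType R) (L : H -> K) : linear L -> forall a x, L (a *: x) = a *: L x.
Proof. by move=> l a x; have := l a x 0; rewrite !addr0 (linear_op0 l) addr0. Qed.

Lemma linear_opB (H K : hilbertType R) (L : H -> K) : linear L -> forall x y, L (x - y) = L x - L y.
Proof. by move=> l x y; rewrite -scaleN1r (linear_opD l) (linear_opZ l) scaleN1r. Qed.

(** As [adjoint] is a choice, some adjoint must first be exhibited: a right inverse of [U], given by
    surjectivity. *)
Lemma unitary_adjointK (H : hilbertType R) (U : H -> H) : is_unitary U ->
  forall y, U (adjoint U y) = y.
Proof.
move=> [linU isoU surU] y.
have [V VP] := choice surU.
have : (exists B : H -> H, forall x y, hdot (U x) y = hdot x (B y)).
  by exists V => x z; rewrite -{1}(VP z) isoU.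
move/(xgetPex (fun=> 0)); rewrite -/(adjoint U) => h.
have [x <-] := surU y; congr U; apply/eqP; rewrite -subr_eq0 -hdot_eq0.
by rewrite hdotBr -h isoU subrr.
Qed.

Section Relation.
Variables (H : hilbertType R) (pi : mob R -> H -> H) (T : H -> H).
Hypothesis upi : forall g, is_unitary (pi g).
Hypothesis bT : bounded_op T.
Hypothesis sT : spectrum T `<=` [set z | `|z| <= 1].

(** The inverse of [(mob_a g)^*], if it exists, lies outside the closed disc and hence outside the
    spectrum. So the chosen [op_inv] is a true inverse. *)
Lemma resolvent_inverse (g : mob R) :
  is_op_inverse (fun v => v - (mob_a g)^* *: T v) (op_inv (fun v => v - (mob_a g)^* *: T v)).
Proof.
set A := fun v => _; apply: (@xgetPex _ (fun x : H => x) (is_op_inverse A)).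
rewrite /A; set a := (mob_a g)^*; have a1 : `|a| < 1 by rewrite /a norm_conjC mob_aP.
have [linT cT] := bT.
have [->|a0] := eqVneq a 0.
  exists id; split; last by move=> x; rewrite scale0r subr0.
    by split=> // x; exact: cvg_id.
  by move=> x; rewrite scale0r subr0.
have [B [[linear_opB cB] K1 K2]] : invertible_op (fun x => T x - a^-1 *: x).
  apply: contrapT => h; have : `|a^-1| <= 1 by exact: (sT h).
  by rewrite normfV invf_le1 ?normr_gt0// => /(lt_le_trans a1); rewrite ltxx.
(* Obtained from [1 - a T = - a (T - a^-1)], where [B] inverts the last factor. *)
exists (fun x => B (- a^-1 *: x)); split.
- split; first by move=> c x y; rewrite scalerDr scalerA mulrC -scalerA linear_opB.
  move=> x; apply: continuous_comp; last exact: cB.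
  exact: scaler_continuous.
- move=> x; have -> : - a^-1 *: (x - a *: T x) = T x - a^-1 *: x; last exact: K1.
  by rewrite scalerBr !scaleNr opprK scalerA mulVf// scale1r addrC.
- move=> x; have := K2 (- a^-1 *: x); set y := B _ => e.
  have : - a *: (T y - a^-1 *: y) = x by rewrite e scalerA mulrNN divff// scale1r.
  by rewrite scalerBr !scaleNr scalerA divff// scale1r opprK addrC.
Qed.

(** Evaluating the association at [x - (mob_a g)^* *: T x] cancels the resolvent. *)
Lemma associated_relation (g : mob R) x : associated pi T ->
  mob_u g *: (pi g (T x) - mob_a g *: pi g x) =
  T (pi g x) - (mob_a g)^* *: T (pi g (T x)).
Proof.
move=> as_; have [_ K1 _] := resolvent_inverse g; have [linU _ _] := upi g.
have [linT _] := bT.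
have := as_ g (x - (mob_a g)^* *: T x).
rewrite /mob_op K1 => /(congr1 (pi g)); rewrite /= (unitary_adjointK (upi g)).
by rewrite !(linear_opZ linU, linear_opB linU, linear_opZ linT, linear_opB linT).
Qed.

End Relation.

Section Blocks.
Variables (H K : hilbertType R) (pi : mob R -> H -> H) (rho : mob R -> K -> K).
Variables (A : H -> H) (S : H -> K) (B : K -> K).
Hypothesis uni : forall g, is_unitary (rep_sum pi rho g).
Hypothesis bA : bounded_op A.
Hypothesis bS : bounded_op S.
Hypothesis bB : bounded_op B.
Hypothesis hom : homogeneous (lower_block A S B).
Hypothesis ass : associated (rep_sum pi rho) (lower_block A S B).

Lemma rep_sum_unitaryl g : is_unitary (pi g).
Proof.
have [linU isoU surU] := uni g; split.
- by move=> a x y; have /(congr1 fst) := linU a (x, 0) (y, 0).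
- move=> x y; have := isoU (x, 0) (y, 0).
  have r0 : rho g 0 = 0.
    have /(congr1 snd) /= := linU 1 (0, 0) (0, 0); rewrite scale1r addr0 scale1r.
    by move/eqP; rewrite -subr_eq0 opprD addrA subrr sub0r oppr_eq0 => /eqP.
  by rewrite /hdot/= /hsum_dot/= r0 !hdot0l !addr0.
- by move=> y; have [[x z] /(congr1 fst)/= <-] := surU (y, 0); exists x.
Qed.

Lemma rep_sum_unitaryr g : is_unitary (rho g).
Proof.
have [linU isoU surU] := uni g; split.
- by move=> a x y; have /(congr1 snd) := linU a (0, x) (0, y).
- move=> x y; have := isoU (0, x) (0, y).
  have [linP _ _] := rep_sum_unitaryl g.
  by rewrite /hdot/= /hsum_dot/= (linear_op0 linP) !hdot0l !add0r.
- by move=> y; have [[x z] /(congr1 snd)/= <-] := surU (0, y); exists z.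
Qed.

Lemma block_relation g (x : hsum H K) :
  mob_u g *: (rep_sum pi rho g (lower_block A S B x) - mob_a g *: rep_sum pi rho g x) =
  lower_block A S B (rep_sum pi rho g x)
    - (mob_a g)^* *: lower_block A S B (rep_sum pi rho g (lower_block A S B x)).
Proof. by case: hom => bL sL _; exact: associated_relation. Qed.

Lemma block_relation11 g x :
  mob_u g *: (pi g (A x) - mob_a g *: pi g x) = A (pi g x) - (mob_a g)^* *: A (pi g (A x)).
Proof. by have /(congr1 fst) := block_relation g (x, 0). Qed.

(** The first claim: the second component of [block_relation] at the vector [(x, 0)]. *)
Lemma block_relation21 g x :
  S (pi g x) - mob_u g *: rho g (S x) =
  (mob_a g)^* *: S (pi g (A x)) + (mob_a g)^* *: B (rho g (S x)).
Proof.
have [linP _ _] := rep_sum_unitaryr g; have [linear_opB _] := bB.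
have /(congr1 snd) /= := block_relation g (x, 0).
rewrite (linear_op0 linear_opB) (linear_op0 linP) (linear_op0 linear_opB) !addr0 scaler0 subr0 => ->.
by rewrite scalerDr opprB addrC subrK.
Qed.

Lemma block_relation22 g y :
  mob_u g *: (rho g (B y) - mob_a g *: rho g y) = B (rho g y) - (mob_a g)^* *: B (rho g (B y)).
Proof.
have [linP _ _] := rep_sum_unitaryl g; have [linA _] := bA; have [linS _] := bS.
have /(congr1 snd) /= := block_relation g (0, y).
by rewrite !(linear_op0 linA, linear_op0 linP, linear_op0 linS, add0r).
Qed.

End Blocks.
End Intertwining.

(** * First-order asymptotics along translations *)

Section Translations.
Variable R : realType.
Notation C := R[i].

(* g is the inverse of z |-> (z - t) / (1 - t z): circle_rep describes pi g^-1. *)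
Definition translation (g : mob R) (t : R) :=
  [/\ mob_u g = 1, mob_a g = (- t)%:C%C & 0 < t < 1].

(** Landau's O(t^2) along translations as [t] decreases to 0; first-order coefficients can then be
    compared without derivatives. *)
Definition bigO2 (f : mob R -> R -> C) := exists K d : R,
  0 < d /\ forall g t, translation g t -> t < d -> cabs (f g t) <= K * t ^+ 2.

Lemma translation_ex (t : R) : 0 < t < 1 -> exists g, translation g t.
Proof.
move=> t01; have ta : `|(- t)%:C%C : C| < 1.
  by rewrite cabsE cabsR normrN -[ltRHS]/(1%:C%C) ltcR gtr0_norm; case/andP: t01.
by exists (Mob (@normr1 C) ta).
Qed.

Lemma bigO2_ext f h : (forall g t, translation g t -> f g t = h g t) -> bigO2 f -> bigO2 h.
Proof.
move=> fh [K [d [d0 hf]]]; exists K, d; split=> // g t tr td.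
by rewrite -fh//; exact: hf.
Qed.

Lemma bigO2D f h : bigO2 f -> bigO2 h -> bigO2 (fun g t => f g t + h g t).
Proof.
move=> [K [d [d0 hf]]] [K' [d' [d'0 hh]]]; exists (K + K'), (Num.min d d'); split.
  by rewrite lt_min d0.
move=> g t tr; rewrite lt_min => /andP[td td'].
by apply: (le_trans (ler_cabsD _ _)); rewrite mulrDl lerD// ?hf ?hh.
Qed.

Lemma bigO2Z (c : C) f : bigO2 f -> bigO2 (fun g t => c * f g t).
Proof.
move=> [K [d [d0 hf]]]; exists (cabs c * K), d; split=> // g t tr td.
by rewrite cabsM -mulrA ler_wpM2l ?cabs_ge0// hf.
Qed.

Lemma bigO2t f : bigO2 f -> bigO2 (fun g t => t%:C%C * f g t).
Proof.
move=> [K [d [d0 hf]]]; exists K, d; split=> // g t tr td.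
have [_ _ /andP[t0 t1]] := tr; rewrite cabsM cabsR gtr0_norm//.
apply: le_trans (hf g t tr td); by rewrite ler_piMl ?cabs_ge0 ?ltW.
Qed.

Lemma bigO2_linear (X : C) : bigO2 (fun _ t => t%:C%C * X) -> X = 0.
Proof.
move=> [K [d [d0 h]]]; apply/eqP; rewrite -cabs_eq0; apply/eqP.
apply: (@le_small_eq0 R _ K (Num.min d 1)); [exact: cabs_ge0|by rewrite lt_min d0 ltr01|].
move=> t; rewrite lt_min => /and3P[t0 td t1].
have [|g tr] := @translation_ex t; first by rewrite t0.
have := h g t tr td; rewrite cabsM cabsR gtr0_norm// expr2 mulrCA.
by rewrite ler_pM2l.
Qed.

Section Asymptotics.
Variables (lambda : R) (mu : C) (H : hilbertType R) (e : int -> H) (pi : mob R -> H -> H).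
Hypothesis be : orthogonal_basis e.
Hypothesis rep : circle_rep lambda mu e pi.
Let p (n i : int) g := coord e (pi g^-1%g (e n)) i.

Lemma expansion_bigO2 n i : bigO2 (fun g t => p n i g - ((n == i)%:R + t%:C%C *
   ((n%:~R - mu) * (n - 1 == i)%:R - (lambda%:C%C + mu + n%:~R) * (n + 1 == i)%:R))).
Proof.
have [K K1 h] := circle_expansion lambda mu n.
have K0 : 0 < K by lra.
exists (2 * K), K^-1; split; first by rewrite invr_gt0.
move=> g t [gu ga /andP[t0 t1]] td; apply: (h _ _ _ _ _ _ be rep gu ga t0).
by rewrite -ltr_pdivlMr// div1r.
Qed.

(** Passing from index [n + 1] to [n - 1] takes two steps, so the term with [c] is of higher order
    and [c] drops out. *)
Lemma down_limit n (c : C) :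
  (forall g t, translation g t -> p n (n - 1) g - t%:C%C * c * p (n + 1) (n - 1) g = 0) ->
  n%:~R - mu = 0.
Proof.
move=> h; apply: bigO2_linear.
have h1 := bigO2Z (-1) (expansion_bigO2 n (n - 1)).
have h2 := bigO2t (bigO2Z c (expansion_bigO2 (n + 1) (n - 1))).
apply: bigO2_ext (bigO2D h1 h2) => g t tr; have := h g t tr => {h h1 h2} /eqP.
rewrite subr_eq0 => /eqP ->.
have -> : (n == n - 1) = false by lia.
have -> : (n + 1 == n - 1) = false by lia.
have -> : (n + 1 - 1 == n - 1) = false by lia.
have -> : (n + 1 + 1 == n - 1) = false by lia.
rewrite eqxx /=; ring.
Qed.

(** Here the second coordinate is a diagonal one, [1 + O(t)], so [c] contributes at first order. *)
Lemma up_limit n (c : C) :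
  (forall g t, translation g t -> p n (n + 1) g - t%:C%C * c * p (n + 1) (n + 1) g = 0) ->
  lambda%:C%C + mu + n%:~R + c = 0.
Proof.
move=> h; apply: bigO2_linear.
have h1 := expansion_bigO2 n (n + 1).
have h2 := bigO2t (bigO2Z (- c) (expansion_bigO2 (n + 1) (n + 1))).
apply: bigO2_ext (bigO2D h1 h2) => g t tr; have := h g t tr => {h h1 h2} /eqP.
rewrite subr_eq0 => /eqP ->.
have -> : (n == n + 1) = false by lia.
have -> : (n - 1 == n + 1) = false by lia.
have -> : (n + 1 - 1 == n + 1) = false by lia.
have -> : (n + 1 + 1 == n + 1) = false by lia.
rewrite eqxx /=; ring.
Qed.

(** First order of the (1,1) relation in the coordinate [n + 2], with [c] and [c'] two consecutive
    coefficients of the shift. *)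
Lemma quadratic_limit n (c c' : C) :
  (forall g t, translation g t -> c * p (n + 1) (n + 2) g - t%:C%C * p n (n + 2) g =
     c' * p n (n + 1) g - t%:C%C * (c * c' * p (n + 1) (n + 1) g)) ->
  c * (lambda%:C%C + mu + n%:~R + 1) = c' * (lambda%:C%C + mu + n%:~R) + c * c'.
Proof.
move=> h; apply/eqP; rewrite -subr_eq0; apply/eqP; apply: bigO2_linear.
have h1 := bigO2Z c (expansion_bigO2 (n + 1) (n + 2)).
have h2 := bigO2t (bigO2Z (-1) (expansion_bigO2 n (n + 2))).
have h3 := bigO2Z (- c') (expansion_bigO2 n (n + 1)).
have h4 := bigO2t (bigO2Z (c * c') (expansion_bigO2 (n + 1) (n + 1))).
apply: bigO2_ext (bigO2D (bigO2D h1 h2) (bigO2D h3 h4)) => g t tr.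
have := h g t tr => {h h1 h2 h3 h4} /eqP; rewrite -subr_eq0 => /eqP h.
have -> : (n + 1 == n + 2) = false by lia.
have -> : (n + 1 - 1 == n + 2) = false by lia.
have -> : (n + 1 + 1 == n + 2) by lia.
have -> : (n == n + 2) = false by lia.
have -> : (n - 1 == n + 2) = false by lia.
have -> : (n == n + 1) = false by lia.
have -> : (n - 1 == n + 1) = false by lia.
have -> : (n + 1 - 1 == n + 1) = false by lia.
have -> : (n + 1 + 1 == n + 1) = false by lia.
rewrite eqxx /= rmorphD rmorph1; apply/eqP; rewrite -subr_eq0 -[X in _ == X]h; apply/eqP; ring.
Qed.
End Asymptotics.
End Translations.

(** * Weights under rotations *)

Section Weights.
Variable R : realType.
Notation C := R[i].

Definition rot_phase (s : R) (g : mob R) : C := cexp (s%:C%C * (0 +i* carg (mob_u g))%C).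

(* The phase absorbs the branch of the logarithm; it is the same for all the
   representations considered, hence only the integer p matters. *)
Definition weight (s : R) (H : hilbertType R) (pi : mob R -> H -> H) (p : int) (v : H) :=
  forall g, mob_a g = 0 -> pi g^-1%g v = (rot_phase s g * mob_u g ^ p) *: v.

Lemma mob_u_neq0 (g : mob R) : mob_u g != 0.
Proof. by rewrite -normr_eq0 mob_uP oner_eq0. Qed.

Lemma mob_u_conjV (g : mob R) : (mob_u g)^* = (mob_u g)^-1.
Proof. by apply: (mulfI (mob_u_neq0 g)); rewrite mob_u_conj divff// mob_u_neq0. Qed.

Lemma conj_exprz (z : C) (q : int) : (z ^ q)^* = z^* ^ q.
Proof.
case: q => n; first by rewrite -!exprnP rmorphXn.
by rewrite -[z ^ _]/((z ^+ n.+1)^-1) -[_^* ^ _]/((z^* ^+ n.+1)^-1) fmorphV rmorphXn.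
Qed.

Lemma mob_u_exprz_conj (g : mob R) (q : int) : (mob_u g ^ q)^* = mob_u g ^ (- q).
Proof. by rewrite conj_exprz mob_u_conjV exprz_inv. Qed.

Lemma rot_phase_conj s g : (rot_phase s g)^* = (rot_phase s g)^-1.
Proof.
rewrite /rot_phase -cexp_conj -cexpN; congr cexp.
by rewrite rmorphM /= conj_real_complex; apply: complex_eq => /=; ring.
Qed.

Lemma rot_phaseD (s : R) (q : int) g : rot_phase (s + q%:~R) g = rot_phase s g * mob_u g ^ q.
Proof.
have eu : mob_u g = cexp (0 +i* carg (mob_u g))%C.
  have u1 : cabs (mob_u g) = 1 by apply: complexI; rewrite -cabsE mob_uP.
  have <- : cln (mob_u g) = (0 +i* carg (mob_u g))%C by rewrite /cln u1 ln1.
  by rewrite cexp_cln// mob_u_neq0.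
rewrite /rot_phase rmorphD rmorph_int mulrDl cexpD cexpM_int.
by rewrite -eu.
Qed.

Lemma rot_phaseN s g : rot_phase (- s) g = (rot_phase s g)^-1.
Proof. by rewrite /rot_phase rmorphN mulNr cexpN. Qed.

Lemma rot_phase_ratio s g (p q : int) :
  (rot_phase s g * mob_u g ^ p) * (rot_phase s g * mob_u g ^ q)^* = mob_u g ^ (p - q).
Proof.
rewrite rmorphM /= rot_phase_conj mob_u_exprz_conj mulrACA divff ?cexp_neq0// mul1r.
by rewrite -expfzDr ?mob_u_neq0.
Qed.

Lemma weight_orthogonal s (H : hilbertType R) pi p q (v w : H) :
  (forall g, is_unitary (pi g)) -> weight s pi p v -> weight s pi q w -> p <> q -> hdot v w = 0.
Proof.
move=> upi wv ww /eqP pq.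
have pq0 : p - q != 0 by rewrite subr_eq0.
(* Rotation by this angle multiplies the inner product by [expi pi = -1], so a single rotation
   suffices. *)
pose x : R := trigo.pi / (p - q)%:~R.
have ux : `|expi x| = 1 by rewrite cabsE cabs_expi.
have a0 : `|0 : C| < 1 by rewrite normr0.
pose g := Mob ux a0.
have [_ iso _] := upi g^-1%g.
have := iso v w; rewrite (wv g erefl) (ww g erefl) hdotZl hdotZr mulrA.
have -> : (rot_phase s g * mob_u g ^ p) * (rot_phase s g * mob_u g ^ q)^* = -1.
  rewrite rot_phase_ratio.
  rewrite [mob_u g]/(expi x) expi_int /x mulrC divfK ?intr_eq0//.
  by apply: complex_eq; rewrite /= ?cospi ?sinpi ?oppr0.
rewrite mulN1r => /eqP; rewrite eq_sym -subr_eq0 opprK -mulr2n mulrn_eq0/=.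
by move/eqP.
Qed.

Lemma weight_circle lambda mu (H : hilbertType R) (e : int -> H) pi n :
  orthogonal_basis e -> circle_rep lambda mu e pi -> weight (lambda / 2) pi n (e n).
Proof. by move=> be rep g ga; rewrite (circle_rotation ga n be rep). Qed.

Lemma weight_plus (lambda : R) (m : int) (H : hilbertType R) (e : nat -> H) pi (j : nat) :
  discrete_plus (lambda + 2 * m%:~R) e pi -> weight (lambda / 2) pi (m + j%:Z) (e j).
Proof.
move=> dp g ga; rewrite (discrete_plus_rotation j ga dp) -/(rot_phase _ g).
rewrite (_ : (_ + _) / 2 = lambda / 2 + m%:~R); last by field.
by rewrite rot_phaseD -mulrA expfzDr ?mob_u_neq0.
Qed.

(** Conjugation turns the exponent [1 - lambda / 2 + k] into [lambda / 2 - 1 - k]. The phase thus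
    agrees with that of the other series, and the weights descend from [- 1 - k]. *)
Lemma weight_minus (lambda : R) (k : int) (H : hilbertType R) (e : nat -> H) pi (j : nat) :
  discrete_minus (2 - lambda + 2 * k%:~R) e pi -> weight (lambda / 2) pi (- 1 - k - j%:Z) (e j).
Proof.
move=> dm g ga; rewrite (discrete_minus_rotation j ga dm) -/(rot_phase _ g).
rewrite (_ : (_ + _) / 2 = - (lambda / 2) + (1 + k)%:~R); last by rewrite rmorphD rmorph1; field.
rewrite rot_phaseD rot_phaseN !rmorphM /= fmorphV /= rot_phase_conj invrK.
congr (_ *: _); rewrite -mulrA; congr (_ * _).
rewrite exprnP !mob_u_exprz_conj -expfzDr ?mob_u_neq0//.
by have -> : - (1 + k) - j%:Z = - 1 - k - j%:Z by ring.
Qed.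

Lemma weight_shift s (H K : hilbertType R) (L : H -> K) pi rho p v : linear L ->
  (forall g x, mob_a g = 0 -> L (pi g^-1%g x) = (mob_u g)^-1 *: rho g^-1%g (L x)) ->
  weight s pi p v -> weight s rho (p + 1) (L v).
Proof.
move=> linL hL wv g ga; have := hL g v ga; rewrite (wv g ga) (linear_opZ linL).
move/(congr1 ( *:%R (mob_u g))); rewrite !scalerA divff ?mob_u_neq0// scale1r => <-.
by rewrite expfzDr ?mob_u_neq0// expr1z mulrCA [mob_u g * _]mulrC.
Qed.

(** Both sides are continuous linear functionals of [y] that agree on the basis, so [dense_kernel]
    applies and no series expansion of [y] is needed. *)
Lemma functional_coord (H : hilbertType R) (K : hilbertType R) (e : int -> H) (L : H -> K) w i y :
  orthogonal_basis e -> bounded_op L -> (forall n, n != i -> hdot (L (e n)) w = 0) ->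
  hdot (L y) w = coord e y i * hdot (L (e i)) w.
Proof.
move=> be [linL cL] h; apply/eqP; rewrite -subr_eq0; apply/eqP.
pose f x : R[i]^o := hdot (L x) w - coord e x i * hdot (L (e i)) w.
have [_ _ tot] := be.
apply: (@dense_kernel R H R[i]^o _ e f tot _ _ _ y).
- move=> a x z; rewrite /f linL hdot_linearl coord_lin /GRing.scale/=; ring.
- have c1 : continuous (fun x : H => hdot (L x) w : R[i]^o).
    by move=> x; apply: (@continuous_comp _ _ _ L (fun z => hdot z w : R[i]^o)); [exact: cL|exact: hdot_continuous].
  have c2 : continuous (fun x : H => coord e x i * hdot (L (e i)) w : R[i]^o).
    pose c := hdot (L (e i)) w / hdot (e i) (e i).
    have cE x : coord e x i * hdot (L (e i)) w = hdot x (e i) * c.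
      by rewrite /Defs.coord /c mulrAC mulrA.
    apply: (@lipschitz_continuous _ _ _ _ (`|e i| * `|c|)).
      by move=> a x z; rewrite !cE hdot_linearl /GRing.scale/=; ring.
    by move=> x; rewrite cE normrM mulrAC ler_wpM2r// mulrC cauchy_schwarz.
  by move=> x; exact: (cvgB (c1 x) (c2 x)).
- move=> n; rewrite /f coord_basis//; have [->|ni] := eqVneq n i.
    by rewrite mul1r subrr.
  by rewrite h// mul0r subrr.
Qed.

End Weights.

(** * Propagation of the vanishing of the lower-left block *)

Section Propagation.
Variable R : realType.
Notation C := R[i].

Section Core.
Variables (H K : hilbertType R) (pi : mob R -> H -> H) (rho : mob R -> K -> K).
Variables (A : H -> H) (S : H -> K) (B : K -> K) (e : int -> H) (lambda : R) (mu : C).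
Hypothesis uni : forall g, is_unitary (rep_sum pi rho g).
Hypothesis bA : bounded_op A.
Hypothesis bS : bounded_op S.
Hypothesis bB : bounded_op B.
Hypothesis hom : homogeneous (lower_block A S B).
Hypothesis ass : associated (rep_sum pi rho) (lower_block A S B).
Hypothesis be : orthogonal_basis e.
Hypothesis rep : circle_rep lambda mu e pi.
Hypothesis mu_nint : forall n : int, n%:~R - mu <> 0.
Hypothesis lmu_nint : forall n : int, lambda%:C%C + mu + n%:~R <> 0.

Let upi := rep_sum_unitaryl uni.
Let urho := rep_sum_unitaryr uni.

(** [circle_rep] describes [pi g^-1], so the block relations are used at inverses throughout. *)
Let rot_rel (g : mob R) : mob_a g = 0 -> mob_a g^-1%g = 0 /\ mob_u g^-1%g = (mob_u g)^-1.
Proof.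
by move=> ga; split; [rewrite /= ga mulr0 oppr0|rewrite /= mob_u_conjV].
Qed.

Lemma shift_A n : weight (lambda / 2) pi (n + 1) (A (e n)).
Proof.
apply: (@weight_shift _ _ _ _ A pi pi) (weight_circle n be rep); first by case: bA.
move=> g x ga; have [a0 u0] := rot_rel ga.
have := block_relation11 uni hom ass g^-1%g x.
by rewrite a0 u0 rmorph0 !scale0r !subr0 => ->.
Qed.

Lemma shift_S n : weight (lambda / 2) rho (n + 1) (S (e n)).
Proof.
apply: (@weight_shift _ _ _ _ S pi rho) (weight_circle n be rep); first by case: bS.
move=> g x ga; have [a0 u0] := rot_rel ga.
have := block_relation21 uni bB hom ass g^-1%g x.
by rewrite a0 u0 rmorph0 !scale0r addr0 => /eqP; rewrite subr_eq0 => /eqP.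
Qed.

Lemma shift_B p y : weight (lambda / 2) rho p y -> weight (lambda / 2) rho (p + 1) (B y).
Proof.
apply: weight_shift; first by case: bB.
move=> g x ga; have [a0 u0] := rot_rel ga.
have := block_relation22 uni bA bS hom ass g^-1%g x.
by rewrite a0 u0 rmorph0 !scale0r !subr0 => ->.
Qed.

Let tr_rel (g : mob R) t : translation g t -> mob_a g^-1%g = t%:C%C /\ mob_u g^-1%g = 1.
Proof.
move=> [gu ga _]; split=> /=; rewrite gu ?ga ?rmorph1//.
by rewrite mul1r rmorphN opprK.
Qed.

(** The coefficient t_n of the weighted shift [A]. *)
Definition shift_coef n : C := coord e (A (e n)) (n + 1).

Lemma A_basis n : A (e n) = shift_coef n *: e (n + 1).
Proof.
apply: (coord_inj be) => i; rewrite coordZ coord_basis//.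
have [<-|ni] := eqVneq (n + 1) i; first by rewrite mulr1 /shift_coef.
rewrite mulr0 /Defs.coord (weight_orthogonal upi (shift_A n) (weight_circle i be rep)) ?mul0r//.
exact/eqP.
Qed.

(** Stated for arbitrary [y] because it is applied to vectors [pi g^-1 (e n)], which need not be
    finite combinations of the basis. *)
Lemma coord_A y n : coord e (A y) (n + 1) = shift_coef n * coord e y n.
Proof.
have h : hdot (A y) (e (n + 1)) = coord e y n * hdot (A (e n)) (e (n + 1)).
  apply: functional_coord => // l ln; rewrite A_basis hdotZl.
  have [_ eo _] := be; rewrite eo ?mulr0//; move/eqP: ln; lia.
by rewrite [LHS]/Defs.coord h -mulrA mulrC.
Qed.

Lemma coordBZ (a : C) x y i : coord e (x - a *: y) i = coord e x i - a * coord e y i.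
Proof. by rewrite addrC -scaleNr coord_lin mulNr addrC. Qed.

Lemma shift_coef_relation n :
  shift_coef n * (lambda%:C%C + mu + n%:~R + 1) = shift_coef (n + 1) * (lambda%:C%C + mu + n%:~R) + shift_coef n * shift_coef (n + 1).
Proof.
apply: (quadratic_limit be rep) => g t tr; have [a1 u1] := tr_rel tr.
have := block_relation11 uni hom ass g^-1%g (e n).
have [linA _] := bA; have [linU _ _] := upi g^-1%g.
rewrite a1 u1 scale1r conj_real_complex => /(congr1 (fun x => coord e x (n + 1 + 1))).
rewrite A_basis (linear_opZ linU) (linear_opZ linA) !coordBZ !coordZ !coord_A.
have -> : n + 2 = n + 1 + 1 by lia.
by move=> ->; ring.
Qed.

(** Otherwise t_(n+1) cancels from [shift_coef_relation], leaving a vanishing product of two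
    consecutive values [lambda + mu + n] and [lambda + mu + n + 1]. *)
Lemma shift_coef_neq n : lambda%:C%C + mu + n%:~R + shift_coef n <> 0.
Proof.
move=> /eqP; rewrite addrC addr_eq0 => /eqP h; have := shift_coef_relation n.
rewrite h => /eqP; rewrite -subr_eq0.
rewrite (_ : _ - _ = - ((lambda%:C%C + mu + n%:~R) * (lambda%:C%C + mu + n%:~R + 1))); last by ring.
rewrite oppr_eq0 mulf_eq0 => /orP[] /eqP; first exact: lmu_nint.
by have := @lmu_nint (n + 1); rewrite rmorphD rmorph1 addrA.
Qed.

(** Gathers the arguments of [S] in the (2,1) relation, so that its image under [S] depends on [e n]
    only through [S (e n)]. *)
Definition translation_defect g t n := pi g^-1%g (e n) - t%:C%C *: pi g^-1%g (A (e n)).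

Lemma S_translation_defect g t n : translation g t ->
  S (translation_defect g t n) = rho g^-1%g (S (e n)) + t%:C%C *: B (rho g^-1%g (S (e n))).
Proof.
move=> tr; have [a1 u1] := tr_rel tr; have [linS _] := bS.
have := block_relation21 uni bB hom ass g^-1%g (e n).
rewrite a1 u1 scale1r conj_real_complex /translation_defect (linear_opB linS) (linear_opZ linS) => /eqP.
by rewrite subr_eq => /eqP ->; rewrite addrC addrA addKr addrC.
Qed.

(** The vectors [S (e l)] have distinct weights, so pairing with [S (e i)] isolates the coordinate
    [i], times a nonzero squared norm. *)
Lemma S_translation_defect_coord g t n i : S (e i) <> 0 -> hdot (S (translation_defect g t n)) (S (e i)) = 0 ->
  coord e (pi g^-1%g (e n)) i - t%:C%C * shift_coef n * coord e (pi g^-1%g (e (n + 1))) i = 0.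
Proof.
move=> /eqP Si; rewrite (@functional_coord _ _ _ e S _ i)//; last first.
  move=> l /eqP li; apply: (weight_orthogonal urho (shift_S l) (shift_S i)) => h.
  by apply: li; apply: addIr h.
have [linU _ _] := upi g^-1%g.
move/eqP; rewrite mulf_eq0 hdot_eq0 (negbTE Si) orbF => /eqP.
by rewrite /translation_defect A_basis (linear_opZ linU) scalerA coordBZ.
Qed.

(** Orthogonality is assumed instead of [S (e n) = 0], so that the lemma also starts the
    propagation, where [S (e n)] may be nonzero. *)
Lemma S_down n :
  (forall g t, translation g t -> hdot (S (translation_defect g t n)) (S (e (n - 1))) = 0) -> S (e (n - 1)) = 0.
Proof.
move=> h; apply: contrapT => S0; apply: (@mu_nint n).
by apply: (down_limit be rep (c := shift_coef n)) => g t tr; exact: S_translation_defect_coord S0 (h g t tr).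
Qed.

Lemma S_up n :
  (forall g t, translation g t -> hdot (S (translation_defect g t n)) (S (e (n + 1))) = 0) -> S (e (n + 1)) = 0.
Proof.
move=> h; apply: contrapT => S0; apply: (@shift_coef_neq n).
by apply: (up_limit be rep (c := shift_coef n)) => g t tr; exact: S_translation_defect_coord S0 (h g t tr).
Qed.

Lemma S_translation_defect0 g t n : translation g t -> S (e n) = 0 -> S (translation_defect g t n) = 0.
Proof.
move=> tr S0; have [linR _ _] := urho g^-1%g; have [linB' _] := bB.
by rewrite S_translation_defect// S0 (linear_op0 linR) (linear_op0 linB') scaler0 addr0.
Qed.

Lemma S_eq0 n : S (e n) = 0 -> forall x, S x = 0.
Proof.
move=> S0; have [linS cS] := bS; have [_ _ tot] := be.
apply: (dense_kernel tot linS cS).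
have up (k : nat) : S (e (n + k%:Z)) = 0.
  elim: k => [|k IH]; first by rewrite addr0.
  rewrite -addn1 PoszD addrA; apply: S_up => g t tr.
  by rewrite (S_translation_defect0 tr IH) hdot0l.
have dn (k : nat) : S (e (n - k%:Z)) = 0.
  elim: k => [|k IH]; first by rewrite subr0.
  rewrite -addn1 PoszD opprD addrA; apply: S_down => g t tr.
  by rewrite (S_translation_defect0 tr IH) hdot0l.
move=> i; have [h|h] := lerP n i.
  by rewrite (_ : i = n + `|i - n|%N%:Z) ?up//; lia.
by rewrite (_ : i = n - `|n - i|%N%:Z) ?dn//; lia.
Qed.

End Core.
End Propagation.

(** * The discrete summands *)

Section Nonintegrality.
Variable R : realType.
Notation C := R[i].

Lemma int_between (n : int) : ~ (0 < (n%:~R : R) < 1).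
Proof. by rewrite ltr0z ltrz1 => /andP[]; lia. Qed.

Lemma complex_int (n : int) : n%:~R = (n%:~R : R)%:C%C.
Proof. by rewrite rmorph_int. Qed.

(** For [lambda < 1] the real parts [(1 - lambda) / 2] and [(1 + lambda) / 2] lie strictly between 0
    and 1. For [lambda = 1] the imaginary parts force [s = 0], the excluded case. *)
Lemma principal_nonint (lambda : R) (s : C) : -1 < lambda <= 1 -> complex.Re s = 0 ->
  ~ (lambda = 1 /\ s = 0) ->
  let mu := ((1 - lambda) / 2)%:C%C + s in
  (forall n : int, n%:~R - mu <> 0) /\ (forall n : int, lambda%:C%C + mu + n%:~R <> 0).
Proof.
move=> /andP[l0 l1] s0 ex mu; split=> n h; apply: ex.
- have := congr1 (@complex.Re R) h; have := congr1 (@complex.Im R) h.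
  rewrite /mu complex_int; case: s s0 {mu h} => a b /= -> hb ha.
  have l : lambda = 1.
    apply: contrapT => /eqP l; apply: (@int_between n); have : lambda < 1 by rewrite lt_neqAle l.
    by move=> ?; apply/andP; split; lra.
  by split=> //; apply: complex_eq => //=; lra.
- have := congr1 (@complex.Re R) h; have := congr1 (@complex.Im R) h.
  rewrite /mu complex_int; case: s s0 {mu h} => a b /= -> hb ha.
  have l : lambda = 1.
    apply: contrapT => /eqP l; apply: (@int_between (- n)); have : lambda < 1 by rewrite lt_neqAle l.
    by rewrite rmorphN => ?; apply/andP; split; lra.
  by split=> //; apply: complex_eq => //=; lra.
Qed.

(** The bound on [sigma] keeps [mu] and [lambda + mu] strictly between 0 and 1. *)
Lemma complementary_nonint (lambda sigma : R) : -1 < lambda < 1 ->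
  0 < sigma < (1 - `|lambda|) / 2 ->
  let mu := ((1 - lambda) / 2 + sigma)%:C%C in
  (forall n : int, n%:~R - mu <> 0) /\ (forall n : int, lambda%:C%C + mu + n%:~R <> 0).
Proof.
move=> /andP[l0 l1] /andP[s0 s1] mu.
have := ler_norm lambda; have := ler_norm (- lambda); rewrite normrN => h1 h2.
split=> n /(congr1 (@complex.Re R)); rewrite /mu complex_int /= => h.
- by apply: (@int_between n); apply/andP; split; lra.
- by apply: (@int_between (- n)); rewrite rmorphN; apply/andP; split; lra.
Qed.

(** * Weights in the sum of the two discrete series *)

Section Discrete.
Variables (Hp Hm : hilbertType R) (ep : nat -> Hp) (em : nat -> Hm).
Variables (pip : mob R -> Hp -> Hp) (pim : mob R -> Hm -> Hm).
Variables (lambda : R) (m k : int).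
Hypothesis uni : forall g, is_unitary (rep_sum pip pim g).
Hypothesis dp : discrete_plus (lambda + 2 * m%:~R) ep pip.
Hypothesis dm : discrete_minus (2 - lambda + 2 * k%:~R) em pim.
Let rho := rep_sum pip pim.
Notation K := (hsum Hp Hm).

Lemma weight_inl j : weight (lambda / 2) rho (m + j%:Z) ((ep j, 0) : K).
Proof.
move=> g ga; have [linM _ _] := rep_sum_unitaryr uni g^-1%g.
rewrite /rho /rep_sum/= (linear_op0 linM) (weight_plus j dp)//.
by congr pair; rewrite scaler0.
Qed.

Lemma weight_inr j : weight (lambda / 2) rho (- 1 - k - j%:Z) ((0, em j) : K).
Proof.
move=> g ga; have [linP _ _] := rep_sum_unitaryl uni g^-1%g.
rewrite /rho /rep_sum/= (linear_op0 linP) (weight_minus j dm)//.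
by congr pair; rewrite scaler0.
Qed.

Lemma weight_fst0 p (v : K) : weight (lambda / 2) rho p v ->
  (forall j : nat, p <> m + j%:Z) -> v.1 = 0.
Proof.
move=> wv pj; have [_ [[_ _ tot] _] _] := dp; apply: tot => j.
have := weight_orthogonal uni wv (weight_inl j) (pj j).
by rewrite /hdot/= /hsum_dot/= hdot0r addr0.
Qed.

Lemma weight_snd0 p (v : K) : weight (lambda / 2) rho p v ->
  (forall j : nat, p <> - 1 - k - j%:Z) -> v.2 = 0.
Proof.
move=> wv pj; have [_ [[_ _ tot] _] _] := dm; apply: tot => j.
have := weight_orthogonal uni wv (weight_inr j) (pj j).
by rewrite /hdot/= /hsum_dot/= hdot0r add0r.
Qed.

(** [B] raises weights, sending those of the first summand to at least [m + 1]; the second summand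
    has weights at most [- 1 - k <= m - 1]. Density of the basis does the rest. *)
Lemma preserve_inl (B : K -> K) : 0 <= m + k -> bounded_op B ->
  (forall p y, weight (lambda / 2) rho p y -> weight (lambda / 2) rho (p + 1) (B y)) ->
  forall v : K, v.2 = 0 -> (B v).2 = 0.
Proof.
move=> mk [linear_opB cB] wB [x y] /= ->.
have [_ [[_ _ tot] _] _] := dp.
pose L x : Hm := (B (x, 0)).2.
have linL : linear L.
  move=> a u v; rewrite /L.
  have -> : ((a *: u + v, 0) : K) = a *: ((u, 0) : K) + ((v, 0) : K).
    by congr pair; rewrite /= scaler0 addr0.
  by rewrite linear_opB.
apply: (@dense_kernel R Hp Hm _ ep L tot linL) => [z|j].
  have ci : continuous (fun u : Hp => (u, 0) : K).
    apply: (@lipschitz_continuous _ _ _ _ 1) => [a u v|u].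
      by congr pair; rewrite /= scaler0 addr0.
    by rewrite mul1r; apply: (le_trans (hsum_norm_le _)); rewrite /= normr0 addr0.
  have cs : continuous (fun v : K => v.2).
    by apply: (@lipschitz_continuous _ _ _ _ 1) => [a u v//|u]; rewrite mul1r hsum_norm_snd.
  apply: (@continuous_comp _ _ _ (fun u => B (u, 0)) (fun v : K => v.2)); last exact: cs.
  by apply: (@continuous_comp _ _ _ (fun u : Hp => (u, 0) : K) B); [exact: ci|exact: cB].
apply: (weight_snd0 (wB _ _ (weight_inl j))) => i; lia.
Qed.

End Discrete.
End Nonintegrality.

(** * Deduction of both claims from the block relations and the weights *)

Theorem theorem5p2 (R : realType) :
  (forall (H1 H2 : hilbertType R)
     (pi1 : mob R -> H1 -> H1) (pi2 : mob R -> H2 -> H2)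
     (T1 : H1 -> H1) (S2 : H1 -> H2) (T2 : H2 -> H2),
     proj_rep pi1 -> proj_rep pi2 ->
     bounded_op T1 -> bounded_op S2 -> bounded_op T2 ->
     homogeneous (lower_block T1 S2 T2) ->
     proj_rep (rep_sum pi1 pi2) ->
     associated (rep_sum pi1 pi2) (lower_block T1 S2 T2) ->
     forall (phi : mob R) (x : H1),
       S2 (pi1 phi x) - mob_u phi *: pi2 phi (S2 x) =
       (mob_a phi)^* *: S2 (pi1 phi (T1 x)) +
       (mob_a phi)^* *: T2 (pi2 phi (S2 x)))
  /\
  (forall (H1 Hp Hm : hilbertType R) (e1 : int -> H1) (ep : nat -> Hp)
     (em : nat -> Hm) (pi1 : mob R -> H1 -> H1) (pip : mob R -> Hp -> Hp)
     (pim : mob R -> Hm -> Hm) (T1 : H1 -> H1) (S2 : H1 -> hsum Hp Hm)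
     (T2 : hsum Hp Hm -> hsum Hp Hm) (lambda : R) (m k : int),
     let pi2 := rep_sum pip pim in
     proj_rep pi1 -> proj_rep pi2 ->
     bounded_op T1 -> bounded_op S2 -> bounded_op T2 ->
     homogeneous (lower_block T1 S2 T2) ->
     proj_rep (rep_sum pi1 pi2) ->
     associated (rep_sum pi1 pi2) (lower_block T1 S2 T2) ->
     -1 < lambda <= 1 ->
     ((exists2 s : R[i], ~ (lambda = 1 /\ s = 0) &
         principal_series lambda s e1 pi1) \/
      (exists sigma : R, complementary_series lambda sigma e1 pi1)) ->
     0 < lambda + 2 * m%:~R -> 0 < 2 - lambda + 2 * k%:~R ->
     discrete_plus (lambda + 2 * m%:~R) ep pip ->
     discrete_minus (2 - lambda + 2 * k%:~R) em pim ->
     forall x : H1, S2 x = 0).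
Proof.
split.
  move=> H1 H2 pi1 pi2 T1 S2 T2 _ _ bT1 bS2 bT2 hom [uni _ _ _] ass phi x.
  exact: (block_relation21 uni bT2 hom ass).
move=> H1 Hp Hm e1 ep em pi1 pip pim T1 S2 T2 lambda m k pi2 _ [uni2 _ _ _] bT1 bS2 bT2 hom
  [uni _ _ _] ass /andP[l0 l1] series_ m0 k0 dp dm.
have [mu [be rep [hmu hlmu]]] : exists mu, [/\ orthogonal_basis e1, circle_rep lambda mu e1 pi1 &
    (forall n : int, n%:~R - mu <> 0) /\ (forall n : int, lambda%:C%C + mu + n%:~R <> 0)].
  case: series_ => [[s ex [l s0 be _ rep]]|[sigma [l sg be _ rep]]].
    by exists (((1 - lambda) / 2)%:C%C + s); split=> //; exact: principal_nonint.
  by exists ((1 - lambda) / 2 + sigma)%:C%C; split=> //; exact: complementary_nonint.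
(* The two positive parameters add up to [2 + 2 * (m + k)], hence [m + k > -1]. *)
have mk : 0 <= m + k.
  rewrite leNgt; apply/negP => h; have : (m + k)%:~R <= -1 :> R by rewrite -[-1]/((-1)%:~R) ler_int; lia.
  rewrite rmorphD; lra.
have S1 := shift_S uni bS2 bT2 hom ass be rep.
have B1 := shift_B uni bT1 bS2 bT2 hom ass.
(* This image has weight [m], too large for the second summand; the next one has weight [m - 1], too
   small for the first. *)
have Sr : (S2 (e1 (m - 1))).2 = 0.
  apply: (weight_snd0 uni2 dm (S1 _)) => j; lia.
have Sl : (S2 (e1 (m - 1 - 1))).1 = 0.
  apply: (weight_fst0 uni2 dp (S1 _)) => j; lia.
apply: (S_eq0 uni bT1 bS2 bT2 hom ass be rep hmu hlmu (n := m - 1 - 1)).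
apply: (S_down uni bT1 bS2 bT2 hom ass be rep hmu) => g t tr.
have [linM _ _] := rep_sum_unitaryr uni2 g^-1%g.
have rS : (pi2 g^-1%g (S2 (e1 (m - 1)))).2 = 0 by rewrite /pi2 /rep_sum/= Sr (linear_op0 linM).
(* The image of the defect stays in the first summand and is therefore orthogonal to
   [S2 (e1 (m - 1 - 1))], as [S_down] requires. *)
have tS : (S2 (translation_defect pi1 T1 e1 g t (m - 1))).2 = 0.
  rewrite (S_translation_defect e1 uni bS2 bT2 hom ass _ tr) -[LHS]/(_.2 + _ *: _.2) rS.
  by rewrite (preserve_inl uni2 dp dm mk bT2 (B1 lambda) rS) add0r scaler0.
rewrite /hdot/= /hsum_dot/= Sl hdot0r add0r [X in hdot X _]tS.
exact: hdot0l.
Qed.
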